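(* Let $\alpha\in(0,1)$, $N\ge 1$, and let $A$ be a real $N\times N$ matrix. Consider the system $$X_{t+1}=X_0+\sum_{j=0}^{t}\frac{\Gamma(t-j+\alpha)}{\Gamma(\alpha)\,\Gamma(t-j+1)}\,(A-I)X_j,\qquad t=0,1,2,\dots,$$ with $X_t\in\mathbb{R}^N$ and $I$ the $N\times N$ identity. The zero solution of this system is asymptotically stable if and only if every root $z$ of the characteristic equation $$\det\!\left(z(1-z^{-1})^{\alpha}I-(A-I)\right)=0$$ satisfies $|z|<1$ (equivalently, the characteristic equation has no root $z$ with $|z|\ge 1$).
   Context: $(1-z^{-1})^{\alpha}$ denotes the principal branch of the power, i.e. $\exp(\alpha\,\mathrm{Log}(1-z^{-1}))$ for $1-z^{-1}\notin(-\infty,0]$, with $0^\alpha=0$. The system above is the solution form of the Caputo-type fractional difference equation of order $\alpha$, $\Delta^\alpha X(t)=(A-I)X(t+\alpha-1)$, $X(0)=X_0$. Asymptotic stability of the zero solution means: it is (Lyapunov) stable and every solution starting sufficiently close to $0$ satisfies $X_t\to 0$ as $t\to\infty$. *)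

(* Defs.v *)
From HB Require Import structures.
From mathcomp Require Import all_boot all_order all_algebra.
From mathcomp Require Import all_classical all_reals all_analysis.
From mathcomp Require Import complex.
Set Implicit Arguments. Unset Strict Implicit. Unset Printing Implicit Defensive.
Import Order.TTheory GRing.Theory Num.Theory.
Import numFieldNormedType.Exports.
Local Open Scope classical_set_scope.
Local Open Scope ring_scope.

Definition Gamma {R : realType} (x : R) : R :=
  \int[@lebesgue_measure R]_(t in [set t : R | 0 < t]) (powR t (x - 1) * expR (- t)).

Definition frac_coef {R : realType} (alpha : R) (k : nat) : R :=
  Gamma (k%:R + alpha) / (Gamma alpha * Gamma (k%:R + 1)).

Definition is_solution {R : realType} (N : nat) (alpha : R) (A : 'M[R]_N)
  (X : nat -> 'cV[R]_N) : Prop :=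
  forall t : nat, X t.+1 = X 0%N +
    \sum_(j < t.+1) frac_coef alpha (t - j) *: ((A - 1%:M) *m X j).

(* A norm on R^N (all norms on R^N are equivalent). *)
Definition vnorm {R : realType} (N : nat) (v : 'cV[R]_N) : R :=
  \sum_(i < N) `|v i 0|.

Definition zero_stable {R : realType} (N : nat) (alpha : R) (A : 'M[R]_N) : Prop :=
  forall eps : R, 0 < eps -> exists2 delta : R, 0 < delta &
    forall X, is_solution alpha A X -> vnorm (X 0%N) < delta ->
      forall t, vnorm (X t) < eps.

Definition zero_attractive {R : realType} (N : nat) (alpha : R) (A : 'M[R]_N) : Prop :=
  exists2 delta : R, 0 < delta &
    forall X, is_solution alpha A X -> vnorm (X 0%N) < delta ->
      vnorm (X t) @[t --> \oo] --> (0 : R).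

Definition zero_asymp_stable {R : realType} (N : nat) (alpha : R) (A : 'M[R]_N) : Prop :=
  zero_stable alpha A /\ zero_attractive alpha A.

Local Open Scope complex_scope.

(* Principal argument in (-pi, pi] of a nonzero complex number. *)
Definition cArg {R : realType} (w : R[i]) : R :=
  let x : R := complex.Re w in let y : R := complex.Im w in
  let r : R := Normc.normc w in
  if (0 <= y)%R then acos (x / r)%R else (- acos (x / r))%R.

(* Principal power w^a = exp(a Log w), with 0^a = 0. *)
Definition cpow {R : realType} (w : R[i]) (a : R) : R[i] :=
  if w == 0 then 0 else
    ((powR (Normc.normc w) a * cos (a * cArg w))%R +i* (powR (Normc.normc w) a * sin (a * cArg w))%R).

Definition char_mx {R : realType} (N : nat) (alpha : R) (A : 'M[R]_N) (z : R[i])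
  : 'M[R[i]]_N :=
  (z * cpow (1 - z^-1) alpha) *: 1%:M - map_mx (fun x : R => x%:C) (A - 1%:M).

(* Main.v *)
(* Put [x = 1 / z] and [B = A - I].  The kernel coefficients are those of
   [(1 - x) ^ (- alpha)], so multiplying the equation by the power series
   [c = (1 - x) ^ alpha] shows that [y = w X], for a row vector [w], satisfies
   [c y = (w X_0) d + x (w B X)] with [d = (1 - x) ^ (alpha - 1)].  The
   coefficients of [c] are absolutely summable with sum [0], negative and
   increasing from index 1 on, and those of [d] are their partial sums and tend
   to [0].

   If [lambda x = (1 - x) ^ alpha] for an eigenvalue [lambda] of [B] with left
   eigenvector [w] and some [|x| <= 1], [x <> 1], the partial sums of
   [c (x)] converge to [(1 - x) ^ alpha] with summable errors (Abel summation);
   comparing partial sums at [x] then shows that [y -> 0] forces [w X_0 = 0].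
   If [x = 1] then [lambda = 0] and [y] is constant.

   Conversely, if no eigenvalue has such an [x], then [(1 - x) ^ alpha - lambda x]
   is invertible among absolutely summable power series: this is Wiener's lemma
   on the closed disc, obtained by Newman's argument of approximating the symbol
   by a polynomial.  Hence solutions of [(c - lambda x) y = u] are bounded, or
   tend to [0], whenever [u] is or does, and the Cayley-Hamilton theorem reduces
   the system to finitely many such scalar equations. *)
Require Import Defs.
From HB Require Import structures.
From mathcomp Require Import all_boot all_order all_algebra.
From mathcomp Require Import all_solvable all_field.
From mathcomp Require Import all_classical all_reals all_analysis.
From mathcomp Require Import measurable_realfun complex.
From mathcomp Require Import ring lra zify.
Import Order.TTheory GRing.Theory Num.Theory.
Import numFieldNormedType.Exports.
Set Implicit Arguments. Unset Strict Implicit. Unset Printing Implicit Defensive.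
Local Open Scope classical_set_scope.
Local Open Scope ring_scope.

(** * The Gamma function *)

Section GammaFunction.
Variable R : realType.
Implicit Types (x t a b : R).
Local Notation mu := (@lebesgue_measure R).

Definition gamma_integrand x t : R := powR t (x - 1) * expR (- t).

Lemma gamma_integrand_ge0 x t : 0 <= gamma_integrand x t.
Proof. by rewrite mulr_ge0 ?powR_ge0 ?expR_ge0. Qed.

Lemma is_derive_gamma_integrand x t : 0 < t ->
  is_derive t 1 (gamma_integrand (x + 1))
    (x * gamma_integrand x t - gamma_integrand (x + 1) t).
Proof.
move=> t0; rewrite /gamma_integrand addrK.
have d1 := is_derive1_powR x t0.
have d2 : is_derive t 1 (fun u : R => expR (- u)) (- expR (- t)).
  have := @is_derive1_comp R expR (-%R : R -> R) t (expR (- t)) (-1) _ _.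
  by rewrite mulrN1; apply.
have -> : x * (t `^ (x - 1) * expR (- t)) - t `^ x * expR (- t) =
  t `^ x *: (- expR (- t)) + expR (- t) *: (x * t `^ (x - 1)).
  by rewrite /GRing.scale /=; ring.
exact: is_deriveM.
Qed.

Lemma gamma_integrand_continuous x t : 0 < t ->
  {for t, continuous (gamma_integrand x)}.
Proof.
move=> t0; apply/differentiable_continuous/derivable1_diffP.
by have := is_derive_gamma_integrand (x - 1) t0; rewrite subrK; case.
Qed.

Lemma gamma_integrand_within x a b : 0 < a ->
  {within `[a, b], continuous (gamma_integrand x)}.
Proof.
move=> a0; apply: continuous_in_subspaceT => t /[!inE] /=.
rewrite in_itv /= => /andP[at_ _].
by apply: gamma_integrand_continuous; exact: lt_le_trans at_.
Qed.

(** Fundamental theorem of calculus for t^x e^(-t). The interval stays away from 0, where the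
    integrand is singular for [x < 1]. *)
Lemma gamma_integrand_parts x a b : 0 < a -> a < b ->
  (x%:E * \int[mu]_(t in `[a, b]) (gamma_integrand x t)%:E =
   (gamma_integrand (x + 1) b - gamma_integrand (x + 1) a)%:E +
   \int[mu]_(t in `[a, b]) (gamma_integrand (x + 1) t)%:E)%E.
Proof.
move=> a0 ab.
have int y : mu.-integrable `[a, b] (EFin \o gamma_integrand y).
  apply: continuous_compact_integrable; first exact: segment_compact.
  exact: gamma_integrand_within.
have lim y c : a <= c -> gamma_integrand y u @[u --> c] --> gamma_integrand y c.
  by move=> ac; apply: gamma_integrand_continuous; exact: lt_le_trans ac.
have := @continuous_FTC2 R
  (fun t => x * gamma_integrand x t - gamma_integrand (x + 1) t)
  (gamma_integrand (x + 1)) a b ab.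
rewrite -EFinB => <-; first last.
- move=> t; rewrite in_itv /= => /andP[at_ tb]; rewrite derive1E.
  have t0 := lt_trans a0 at_.
  by have [_ ->] := is_derive_gamma_integrand x t0.
- split.
  + move=> t; rewrite in_itv /= => /andP[at_ tb].
    have t0 := lt_trans a0 at_.
    by have [] := is_derive_gamma_integrand x t0.
  + by apply: cvg_at_right_filter; apply: lim.
  + by apply: cvg_at_left_filter; apply: lim; exact: ltW.
- apply: continuous_in_subspaceT => t /[!inE] /=.
  rewrite in_itv /= => /andP[at_ _].
  by apply: cvgB; [apply: cvgMr; exact: lim | exact: lim].
rewrite -integralZl //; last exact: int.
rewrite -integralD //=; last exact: int.
  by apply: eq_integral => t _; rewrite -EFinD subrK EFinM.
have -> : (fun t => (x * gamma_integrand x t - gamma_integrand (x + 1) t)%:E) =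
  (fun t => x%:E * (EFin \o gamma_integrand x) t - (EFin \o gamma_integrand (x + 1)) t)%E.
  by apply/funext => t /=.
by apply: integrableB => //; apply: integrableZl.
Qed.

(** Extended-real integral: the functional equation is proved for it first, and finiteness is then
    deduced from that equation. *)
Local Notation Gammae x :=
  (\int[mu]_(t in [set t : R | (0 < t)%R]) (gamma_integrand x t)%:E)%E.

(** Compact exhaustion of the open half-line. Starting at 2 keeps the left end strictly below the
    right one. *)
Definition gamma_domain n : set R := `[n.+2%:R^-1, n.+2%:R].

Lemma gamma_domain_gt0 n : 0 < (n.+2%:R : R)^-1.
Proof. by rewrite invr_gt0 ltr0n. Qed.

Lemma bigcup_gamma_domain : \bigcup_n gamma_domain n = [set t : R | 0 < t].
Proof.
apply/seteqP; split => t /=.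
  move=> [n _]; rewrite /gamma_domain /= in_itv /= => /andP[h _].
  exact: lt_le_trans (gamma_domain_gt0 n) h.
move=> t0; pose m := maxn (Num.truncn t) (Num.truncn t^-1).
exists m => //; rewrite /gamma_domain /= in_itv /=.
have le y : 0 <= y -> (Num.truncn y <= m)%N -> y <= m.+2%:R.
  move=> y0 ym; have /andP[_ /ltW yt] := truncn_itv y0.
  by apply: le_trans yt _; rewrite ler_nat ltnW // ltnS.
apply/andP; split; last by rewrite le ?leq_maxl // ltW.
rewrite -[leRHS]invrK lef_pV2 ?posrE ?invr_gt0 ?ltr0n //.
by rewrite le ?leq_maxr // invr_ge0 ltW.
Qed.

Lemma measurable_gamma_integrand x :
  measurable_fun [set t : R | 0 < t] (gamma_integrand x).
Proof.
rewrite -set_itvoy; apply: open_continuous_measurable_fun; first exact: interval_open.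
by move=> t; rewrite set_itvoy inE /=; exact: gamma_integrand_continuous.
Qed.

Lemma Gammae_cvg x :
  (\int[mu]_(t in gamma_domain n) (gamma_integrand x t)%:E @[n --> \oo] --> Gammae x)%E.
Proof.
rewrite -bigcup_gamma_domain; apply: ge0_nondecreasing_set_cvg_integral.
- move=> m n mn; apply/subsetPset; rewrite /gamma_domain => t /=.
  rewrite !in_itv /= => /andP[h1 h2]; apply/andP; split.
    by apply: le_trans h1; rewrite lef_pV2 ?posrE ?ltr0n // ler_nat !ltnS.
  by apply: le_trans h2 _; rewrite ler_nat !ltnS.
- by move=> n; exact: measurable_itv.
- move=> n; apply/measurable_EFinP.
  apply: measurable_funS (measurable_gamma_integrand x).
    by have := @measurable_itv R `]0, +oo[; rewrite set_itvE.
  by rewrite -bigcup_gamma_domain; apply: bigcup_sup.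
- by move=> n t _; rewrite lee_fin gamma_integrand_ge0.
Qed.

(** For an integer m >= x, the exponential series gives e^t >= t^(m+1) / (m+1)!. *)
Lemma powR_expRN_bound x : exists K, forall t, 1 <= t -> t `^ x * expR (- t) <= K / t.
Proof.
pose m := (Num.truncn (Num.max 0 x)).+1.
have mx : x <= m%:R.
  have : 0 <= Num.max 0 x by rewrite le_max lexx.
  by move=> /truncn_itv /andP[_ /ltW]; rewrite ge_max => /andP[].
exists (m.+1)`!%:R => t t1; have t0 : 0 < t by exact: lt_le_trans t1.
have f0 : 0 < (m.+1)`!%:R :> R by rewrite ltr0n fact_gt0.
rewrite expRN ler_pdivrMr ?expR_gt0 // mulrAC ler_pdivlMr //.
apply: (@le_trans _ _ (t ^+ m * t)).
  rewrite ler_pM2r // -powR_mulrn ?(ltW t0) //. exact: ler_powR.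
rewrite -exprSr -ler_pdivrMl // mulrC.
by apply: le_trans (expR_ge1Dxn m (ltW t0)); rewrite lerDr.
Qed.

Lemma gamma_integrand_cvg0l x : 0 < x ->
  gamma_integrand (x + 1) n.+2%:R^-1 @[n --> \oo] --> 0.
Proof.
move=> x0; apply: (@squeeze_cvgr _ _ _ _ (cst 0) (fun n => (n.+2%:R^-1 : R) `^ x)).
- near=> n; rewrite /= gamma_integrand_ge0 /= /gamma_integrand addrK ler_piMr ?powR_ge0 //.
- exact: cvg_cst.
- have /cvg_at_rightP := powR_cvg0 x0; apply; split.
    by move=> n; exact: gamma_domain_gt0.
  by have := @cvg_harmonic R; rewrite -cvg_shiftS.
Unshelve. all: by end_near. Qed.

Lemma gamma_integrand_cvg0r x :
  gamma_integrand (x + 1) n.+2%:R @[n --> \oo] --> 0.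
Proof.
have [K hK] := powR_expRN_bound x.
apply: (@squeeze_cvgr _ _ _ _ (cst 0) (fun n => K * harmonic n.+1)).
- near=> n; rewrite /= gamma_integrand_ge0 /= /gamma_integrand addrK.
  by apply: hK; rewrite ler1n.
- exact: cvg_cst.
- rewrite -(mulr0 K); apply: cvgMr.
  by have := @cvg_harmonic R; rewrite -cvg_shiftS.
Unshelve. all: by end_near. Qed.

Lemma Gammae_ge0 x : (0 <= Gammae x)%E.
Proof. by apply: integral_ge0 => t _; rewrite lee_fin gamma_integrand_ge0. Qed.

(** Integration by parts on the exhaustion; both boundary terms vanish in the limit. *)
Lemma Gammae_step x : 0 < x -> (Gammae (x + 1) = x%:E * Gammae x)%E.
Proof.
move=> x0.
have h1 := @cvgeZl _ _ _ _ _ x%:E isT (@Gammae_cvg x).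
have h2 : ((gamma_integrand (x + 1) n.+2%:R - gamma_integrand (x + 1) n.+2%:R^-1)%:E +
   \int[mu]_(t in gamma_domain n) (gamma_integrand (x + 1) t)%:E @[n --> \oo]
   --> 0%:E + Gammae (x + 1))%E.
  apply: cvgeD; last exact: Gammae_cvg.
    by rewrite fin_num_adde_defr.
  apply: cvg_EFin; first by near=> n.
  rewrite -(subr0 0); apply: cvgB; first exact: gamma_integrand_cvg0r.
  exact: gamma_integrand_cvg0l.
rewrite -[LHS]add0e; symmetry; apply: cvg_unique h1 _; first exact: ereal_hausdorff.
apply: cvg_trans h2; apply: near_eq_cvg; near=> n.
rewrite -gamma_integrand_parts ?gamma_domain_gt0 //.
rewrite (@lt_trans _ _ 1) // ?invf_lt1 ?ltr0n // ?ltr1n //.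
Unshelve. all: by end_near. Qed.

Lemma Gammae1 : Gammae 1 = 1%E.
Proof.
have -> : Gammae 1 = (\int[mu]_(t in `[0%R, +oo[) (expR (- t))%:E)%E.
  have m : measurable_fun (`]0, +oo[ : set R) (EFin \o (fun t => expR (- t))).
    by apply/measurable_EFinP; apply: measurableT_comp.
  rewrite -integral_itv_obnd_cbnd // set_itvoy; apply: eq_integral => t _.
  by rewrite /gamma_integrand subrr powRr0 mul1r.
rewrite (@ge0_continuous_FTC2y _ _ (fun t => - expR (- t)) 0 0).
- by rewrite oppr0 expR0 -EFinB opprK add0r.
- by move=> t _; exact: expR_ge0.
- by apply: continuous_subspaceT => t; apply: continuous_comp;
    [exact: opp_continuous|exact: continuous_expR].
- by rewrite -oppr0; apply: cvgN; exact: cvgr_expR.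
- by move=> t _; apply: derivableN; apply/derivable1_diffP;
    apply: differentiable_comp => //; apply/derivable1_diffP.
- by apply: cvg_at_right_filter; apply: cvgN; apply: continuous_comp;
    [exact: opp_continuous|exact: continuous_expR].
- move=> t _; rewrite derive1E.
  have d2 : is_derive t 1 (fun u : R => expR (- u)) (- expR (- t)).
    have := @is_derive1_comp R expR (-%R : R -> R) t (expR (- t)) (-1) _ _.
    by rewrite mulrN1; apply.
  by have [_ ->] := is_deriveN d2; rewrite opprK.
Qed.

Lemma Gammae_natD1 n : (Gammae (n%:R + 1) < +oo)%E.
Proof.
elim: n => [|n IH]; first by rewrite add0r Gammae1 ltry.
by rewrite Gammae_step ?ltr0n // -natr1 lte_mul_pinfty.
Qed.

(** By the functional equation it is enough to treat x + 1, where t^x <= 1 + t^n for an integer n >=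
    x allows a comparison with Gamma at 1 and at n + 1. *)
Lemma Gammae_lty x : 0 < x -> (Gammae x < +oo)%E.
Proof.
move=> x0; have xx : 0 <= x by exact: ltW.
suff : (Gammae (x + 1) < +oo)%E.
  rewrite Gammae_step //; apply: contraTT; rewrite -!leNgt !leye_eq => /eqP ->.
  by rewrite gt0_muley ?lte_fin.
pose n := (Num.truncn x).+1.
have xn : x <= n%:R by have /andP[_ /ltW] := truncn_itv xx.
have mD : measurable [set t : R | 0 < t] by rewrite -set_itvoy.
have mE y : measurable_fun [set t : R | 0 < t] (fun t => (gamma_integrand y t)%:E).
  by apply/measurable_EFinP; exact: measurable_gamma_integrand.
apply: (@le_lt_trans _ _ (Gammae 1 + Gammae (n%:R + 1))%E); last first.
  by rewrite lte_add_pinfty ?Gammae1 ?ltry // Gammae_natD1.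
rewrite -ge0_integralD //; do ?[exact: mE | by move=> t _;
  rewrite lee_fin gamma_integrand_ge0].
apply: ge0_le_integral => //.
- by move=> t _; rewrite lee_fin gamma_integrand_ge0.
- exact: mE.
- by apply: emeasurable_funD; exact: mE.
move=> t /= t0; rewrite -EFinD lee_fin /gamma_integrand subrr !addrK powRr0 -mulrDl.
rewrite ler_pM2r ?expR_gt0 //; have [t1|t1] := leP t 1.
  rewrite (@le_trans _ _ 1) // ?lerDl ?powR_ge0 //.
  by rewrite -(powRr0 t); apply: ger_powR => //; rewrite t0.
by rewrite (@le_trans _ _ (t `^ n%:R)) ?lerDr //; apply: ler_powR => //; exact: ltW.
Qed.

Lemma GammaE x : 0 < x -> (Gamma x)%:E = Gammae x.
Proof.
by move=> x0; rewrite /Gamma /Rintegral fineK // ge0_fin_numE ?Gammae_lty // Gammae_ge0.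
Qed.

Lemma Gamma1 : Gamma 1 = 1 :> R.
Proof. by apply: EFin_inj; rewrite GammaE // Gammae1. Qed.

Lemma GammaD1 x : 0 < x -> Gamma (x + 1) = x * Gamma x.
Proof.
by move=> x0; apply: EFin_inj; rewrite EFinM !GammaE ?addr_gt0 // Gammae_step.
Qed.

(** For t > 0 and x in (0,1] one has 1 <= t^(x-1) + t^x; integrating against e^(-t) gives 1 <= (1 +
    x) Gamma(x). *)
Lemma Gamma_gt0_le1 x : 0 < x -> x <= 1 -> 0 < Gamma x.
Proof.
move=> x0 x1; have x10 : 0 < x + 1 by rewrite addr_gt0.
suff : 1 <= Gamma x + Gamma (x + 1).
  rewrite GammaD1 // -{1}[Gamma x]mul1r -mulrDl => h.
  by rewrite -(pmulr_rgt0 _ x10) addrC; exact: lt_le_trans h.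
rewrite -lee_fin EFinD !GammaE // -Gammae1.
have mD : measurable [set t : R | 0 < t] by rewrite -set_itvoy.
have mE y : measurable_fun [set t : R | 0 < t] (fun t => (gamma_integrand y t)%:E).
  by apply/measurable_EFinP; exact: measurable_gamma_integrand.
rewrite -ge0_integralD //; do ?[exact: mE | by move=> t _;
  rewrite lee_fin gamma_integrand_ge0].
apply: ge0_le_integral => //.
- by move=> t _; rewrite lee_fin gamma_integrand_ge0.
- exact: mE.
- by apply: emeasurable_funD; exact: mE.
move=> t /= t0; rewrite -EFinD lee_fin /gamma_integrand subrr addrK powRr0 -mulrDl.
rewrite ler_pM2r ?expR_gt0 //; have [t1|t1] := leP t 1.
  rewrite (@le_trans _ _ (t `^ (x - 1))) ?lerDl ?powR_ge0 // -{1}(powRr0 t).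
  by apply: ger_powR; rewrite ?t0 // subr_le0.
by rewrite (@le_trans _ _ (t `^ x)) ?lerDr ?powR_ge0 // -(powRr0 t);
  apply: ler_powR => //; exact: ltW.
Qed.

Lemma frac_coef0 x : 0 < x -> x <= 1 -> frac_coef x 0 = 1.
Proof.
move=> x0 x1; rewrite /frac_coef !add0r Gamma1 mulr1 divff //.
by rewrite gt_eqF // Gamma_gt0_le1.
Qed.

(** Binomial recurrence of (1 - X)^(-x). With [frac_coef0] it is all that is used later about the
    Gamma function. *)
Lemma frac_coefS x k : 0 < x ->
  k.+1%:R * frac_coef x k.+1 = (k%:R + x) * frac_coef x k.
Proof.
move=> x0; rewrite /frac_coef -natr1 [k%:R + 1 + x]addrAC.
rewrite GammaD1 ?ltr_wpDl // (@GammaD1 (k%:R + 1)) ?ltr_wpDl //.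
have k1 : k%:R + 1 != 0 :> R by rewrite natr1 pnatr_eq0.
rewrite [Gamma x * _]mulrCA [(_ * (_ * _))^-1]invfM.
by rewrite [LHS]mulrCA (mulVKf k1) mulrA.
Qed.

End GammaFunction.

(** * Binomial coefficients of fractional order *)

Section Coefficients.
Variables (R : realType) (a : R).

(* The coefficients of [(1 - x) ^ (a - 1)]. *)
Fixpoint dcoef n : R := if n is m.+1 then dcoef m * (1 - a / m.+1%:R) else 1.

(* The coefficients of [(1 - x) ^ a]. *)
Definition ccoef n : R := if n is m.+1 then - (a * dcoef m / m.+1%:R) else 1.

Lemma dcoefS n : dcoef n.+1 = dcoef n + ccoef n.+1.
Proof. by rewrite /= mulrBr mulr1 mulrA (mulrC a). Qed.

Lemma sum_ccoef n : \sum_(k < n.+1) ccoef k = dcoef n.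
Proof.
by elim: n => [|n IH]; [rewrite big_ord1|rewrite big_ord_recr IH [RHS]dcoefS].
Qed.

Lemma ccoefS n : n.+1%:R * ccoef n.+1 = - (a * dcoef n).
Proof. by rewrite /ccoef mulrN mulrC divfK // pnatr_eq0. Qed.

(** Together with [ccoefS] this is the binomial recurrence (n+1) c_(n+1) = (n - a) c_n. *)
Lemma ccoefE n : (a - n%:R) * ccoef n = a * dcoef n.
Proof.
case: n => [|n]; first by rewrite subr0.
have n0 : n.+1%:R != 0 :> R by rewrite pnatr_eq0.
by rewrite mulrBl ccoefS opprK dcoefS mulrDr addrC.
Qed.

Hypotheses (a_gt0 : 0 < a) (a_lt1 : a < 1).

Lemma dcoef_factor_gt0 n : 0 < 1 - a / n.+1%:R.
Proof.
rewrite subr_gt0 ltr_pdivrMr ?ltr0n // mul1r.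
by apply: lt_le_trans a_lt1 _; rewrite ler1n.
Qed.

Lemma dcoef_gt0 n : 0 < dcoef n.
Proof. by elim: n => //= n IH; rewrite mulr_gt0 // dcoef_factor_gt0. Qed.

Lemma ccoefS_lt0 n : ccoef n.+1 < 0.
Proof. by rewrite oppr_lt0 divr_gt0 ?ltr0n ?mulr_gt0 ?dcoef_gt0. Qed.

Lemma dcoefS_le n : dcoef n.+1 <= dcoef n.
Proof. by rewrite dcoefS gerDl ltW // ccoefS_lt0. Qed.

Lemma dcoef_le1 n : dcoef n <= 1.
Proof. by elim: n => // n; apply: le_trans; exact: dcoefS_le. Qed.

(** The absolute value a d_n / (n+1) is a product of nonincreasing positive factors. *)
Lemma ccoef_le m n : (m <= n)%N -> ccoef m.+1 <= ccoef n.+1.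
Proof.
move=> mn; rewrite lerN2 -!mulrA ler_wpM2l ?(ltW a_gt0) //.
apply: ler_pM; rewrite ?invr_ge0 ?ler0n ?(ltW (dcoef_gt0 _)) //.
  elim: n mn => [|n IH]; first by rewrite leqn0 => /eqP ->.
  rewrite leq_eqVlt => /predU1P[->//|/IH]; apply: le_trans; exact: dcoefS_le.
by rewrite lef_pV2 ?posrE ?ltr0n // ler_nat ltnS.
Qed.

(* [1 - a / k <= 1 / (1 + a / k)], and the product of the denominators
   dominates the harmonic series. *)
Lemma dcoef_harmonic n : dcoef n * (1 + a * series harmonic n) <= 1.
Proof.
elim: n => [|n IH]; first by rewrite /series /= big_geq // mulr0 addr0 mulr1.
have h : 1 + a * series harmonic n.+1 <=
    (1 + a * series harmonic n) * (1 + a / n.+1%:R).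
  rewrite /series /= big_nat_recr //= -subr_ge0.
  set S := \sum_(_ <= _ < _) _; rewrite [X in 0 <= X](_ : _ = a * S * (a / n.+1%:R)).
    rewrite mulr_ge0 ?divr_ge0 ?(ltW a_gt0) // mulr_ge0 ?(ltW a_gt0) // sumr_ge0 //.
  by rewrite /harmonic; ring.
apply: le_trans IH => /=.
apply: le_trans (ler_wpM2l _ h) _.
  by rewrite mulr_ge0 ?(ltW (dcoef_gt0 _)) // ltW // dcoef_factor_gt0.
set D := dcoef n; set S := 1 + a * _; set q := a / _.
have -> : D * (1 - q) * (S * (1 + q)) = D * S * (1 - q ^+ 2) by ring.
rewrite ler_piMr ?gerBl ?sqr_ge0 // mulr_ge0 ?(ltW (dcoef_gt0 _)) // addr_ge0 //.
by rewrite mulr_ge0 ?(ltW a_gt0) // sumr_ge0 // => i _; exact: harmonic_ge0.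
Qed.

Lemma dcoef_cvg0 e : 0 < e -> exists n0, forall n, (n0 <= n)%N -> dcoef n < e.
Proof.
move=> e0.
(* By [dcoef_harmonic], d_n < e as soon as the harmonic sum reaches 1 / (e a); if it never did, the
   series would be bounded and hence convergent. *)
have [n hn] : exists n, e^-1 / a <= series (@harmonic R) n.
  apply: contrapT => /forallNP h; apply: (@dvg_harmonic R).
  apply: nondecreasing_is_cvgn.
    by apply: nondecreasing_series => i _ _; exact: harmonic_ge0.
  by exists (e^-1 / a) => _ [n _ <-]; apply: ltW; rewrite ltNge; apply/negP; exact: h.
exists n => m; have : dcoef n < e.
  have S0 : 0 < 1 + a * series harmonic n.
    by rewrite ltr_pwDl // mulr_ge0 ?(ltW a_gt0) // /series /= sumr_ge0.
  have := dcoef_harmonic n; rewrite -ler_pdivlMr // div1r => /le_lt_trans; apply.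
  rewrite -[ltRHS]invrK ltf_pV2 ?posrE ?invr_gt0 //.
  apply: (@le_lt_trans _ _ (a * series harmonic n)); last by rewrite ltrDr.
  by rewrite mulrC -ler_pdivrMr.
move=> dn nm; apply: le_lt_trans dn; elim: m nm => [|m IH].
  by rewrite leqn0 => /eqP ->.
rewrite leq_eqVlt => /predU1P[->//|/IH]; apply: le_trans; exact: dcoefS_le.
Qed.

End Coefficients.

(** * Principal powers as limits of partial sums *)

Section PrincipalPower.
Variables (R : realType) (a : R).
Local Notation "x %:C" := (real_complex R x) : ring_scope.
Local Notation C := R[i].
Local Notation normc := (@Normc.normc R).

Definition Cpoly n : {poly C} := \poly_(i < n.+1) (ccoef a i)%:C.

Lemma CpolyS n : Cpoly n.+1 = Cpoly n + ((ccoef a n.+1)%:C)%:P * 'X^(n.+1).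
Proof. by rewrite /Cpoly !poly_def big_ord_recr /= mul_polyC. Qed.

(** The full series solves (1 - X) C' + a C = 0; truncating it leaves only one residual term, of
    degree n. *)
Lemma Cpoly_ode n :
  (1 - 'X) * deriv (Cpoly n) + (a%:C)%:P * Cpoly n = ((a * dcoef a n)%:C)%:P * 'X^n.
Proof.
elim: n => [|n IH].
  have -> : Cpoly 0 = 1 by rewrite /Cpoly poly_def big_ord1 expr0 scale1r.
  by rewrite -(polyC1) derivC mulr0 add0r /= mulr1 expr0 !polyC1.
rewrite CpolyS; have := ccoefS a n; have := ccoefE a n.+1.
move: (ccoef a n.+1) (dcoef a n) (dcoef a n.+1) IH => c d d' IH.
move=> /(congr1 (fun y => (y%:C)%:P)) + /(congr1 (fun y => (y%:C)%:P)).
rewrite !rmorphM /= !rmorphB !rmorphN !rmorphM /= !rmorph_nat => h1 h2.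
rewrite derivD derivM derivC mul0r add0r derivXn /= -[_ *+ n.+1]mulr_natl.
rewrite mulrDr mulrDr addrACA IH -[(a * d)%:C%:P]opprK rmorphM /= rmorphM -h2.
rewrite -h1 exprS.
move: 'X (c%:C)%:P (a%:C)%:P ('X^n) (n.+1%:R : {poly C}) => x u v w k; ring.
Qed.
(** Along the ray t -> t x, a complex polynomial and its t-derivative become pairs of real
    polynomials, so real calculus applies. *)
Lemma horner_ray (p : {poly C}) (x : C) : exists U V : {poly R}, forall t : R,
  p.[t%:C * x] = Complex U.[t] V.[t] /\
  x * (deriv p).[t%:C * x] = Complex (deriv U).[t] (deriv V).[t].
Proof.
case: x => x1 x2; elim/poly_ind: p => [|p [c1 c2] [U [V h]]].
  by exists 0, 0 => t; rewrite !deriv0 !horner0 mulr0.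
exists ('X * (x1%:P * U - x2%:P * V) + c1%:P), ('X * (x1%:P * V + x2%:P * U) + c2%:P).
move=> t; have [h1 h2] := h t.
rewrite !(derivD, derivM, derivB, derivN, derivC, derivX).
rewrite !(hornerD, hornerM, hornerN, hornerX, hornerC); split.
  rewrite h1.
  by apply/eqP; rewrite eq_complex /=; apply/andP; split; apply/eqP; ring.
set x := Complex x1 x2 in h1 h2 *.
transitivity (t%:C * x * (x * (deriv p).[t%:C * x]) + x * p.[t%:C * x]); first by ring.
rewrite h1 h2.
by apply/eqP; rewrite eq_complex /=; apply/andP; split; apply/eqP; ring.
Qed.


(** The function is the real part of (u + i v) exp(- a (L + i th)); the pair (v, - u) in place of
    (u, v) gives the imaginary part. *)
Lemma is_derive_rotation (u v L th : R -> R) (t du dv dL dth : R) :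
  is_derive t 1 u du -> is_derive t 1 v dv -> is_derive t 1 L dL ->
  is_derive t 1 th dth ->
  is_derive t 1
    (fun s => expR (- (a * L s)) * (u s * cos (a * th s) + v s * sin (a * th s)))
    (expR (- (a * L t)) *
      ((du - a * (dL * u t - dth * v t)) * cos (a * th t) +
       (dv - a * (dL * v t + dth * u t)) * sin (a * th t))).
Proof.
move=> Du Dv DL Dth.
have scal f df : is_derive t 1 f df -> is_derive t 1 (fun s => a * f s) (a * df).
  by move=> Df; exact: is_deriveZ.
have DN : is_derive t 1 (fun s => - (a * L s)) (- (a * dL)).
  exact: is_deriveN (scal _ _ DL).
have DE := @is_derive1_comp R expR _ t _ _ (is_derive_expR _) DN.
have Dc := @is_derive1_comp R cos _ t _ _ (is_derive_cos _) (scal _ _ Dth).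
have Ds := @is_derive1_comp R sin _ t _ _ (is_derive_sin _) (scal _ _ Dth).
have := is_deriveM DE (is_deriveD (is_deriveM Du Dc) (is_deriveM Dv Ds)).
move=> D; apply: is_derive_eq D _; rewrite /GRing.scale !fctE /=; ring.
Qed.

Lemma Re_le_normc (z : C) : `|complex.Re z| <= normc z.
Proof. by case: z => x y /=; rewrite -sqrtr_sqr ler_wsqrtr // lerDl sqr_ge0. Qed.

Lemma Im_le_normc (z : C) : `|complex.Im z| <= normc z.
Proof. by case: z => x y /=; rewrite -sqrtr_sqr ler_wsqrtr // lerDr sqr_ge0. Qed.

Lemma normc_le_ReIm (z : C) : normc z <= `|complex.Re z| + `|complex.Im z|.
Proof.
case: z => x y /=; rewrite -[leRHS]ger0_norm ?addr_ge0 // -sqrtr_sqr ler_wsqrtr //.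
by rewrite sqrrD !real_normK ?num_real // [leRHS]addrAC lerDl mulrn_wge0.
Qed.

Lemma normc_ge0 (z : C) : 0 <= normc z.
Proof. by case: z => x y; exact: sqrtr_ge0. Qed.

Lemma normcX (z : C) n : normc (z ^+ n) = normc z ^+ n.
Proof.
by elim: n => [|n IH]; [exact: Normc.normc1|rewrite !exprS Normc.normcM IH].
Qed.

Lemma normc_real (x : R) : normc x%:C = `|x|.
Proof. by rewrite /= expr0n /= addr0 sqrtr_sqr. Qed.


Lemma ln_sqrt (y : R) : 0 <= y -> ln (Num.sqrt y) = ln y / 2.
Proof. by move=> y0; rewrite -powR12_sqrt // ln_powR mulrC. Qed.

Lemma sqrt_sqrD (x y : R) : 0 < x -> Num.sqrt (x ^+ 2 + y ^+ 2) = x * Num.sqrt (1 + (y / x) ^+ 2).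
Proof.
move=> x0; rewrite -[X in _ = X * _](gtr0_norm x0) -[`|x|]sqrtr_sqr -sqrtrM ?sqr_ge0 //.
by congr Num.sqrt; field; rewrite gt_eqF.
Qed.

Lemma cArg_atan (x y : R) : 0 < x -> cArg (Complex x y) = atan (y / x).
Proof.
move=> x0; rewrite /cArg /=.
have -> : x / Num.sqrt (x ^+ 2 + y ^+ 2) = cos (atan (y / x)).
  by rewrite cos_atan sqrt_sqrD // invfM mulrA divff ?gt_eqF ?mul1r.
have h1 := atan_gtNpi2 (y / x); have h2 := atan_ltpi2 (y / x); have p0 := pi_gt0 R.
case: ifPn => y0.
  rewrite cosK // in_itv /=; apply/andP; split; last by lra.
  by rewrite -(@atan0 R) le_atan // divr_ge0 // ltW.
rewrite cosKN ?opprK //; apply/andP; split; first by lra.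
by rewrite -(@atan0 R) le_atan // pmulr_lle0 ?invr_gt0 // ltW // ltNge.
Qed.

(** On the right half-plane the logarithm has coordinates that are differentiable in x and y: half
    the logarithm of the squared modulus, and an arctangent. *)
Lemma cpowE (x y : R) : 0 < x ->
  cpow (Complex x y) a = (expR (a * (ln (x ^+ 2 + y ^+ 2) / 2)))%:C *
    Complex (cos (a * atan (y / x))) (sin (a * atan (y / x))).
Proof.
move=> x0; rewrite /cpow eq_complex /= gt_eqF //= cArg_atan //.
have N0 : 0 < x ^+ 2 + y ^+ 2 by rewrite ltr_pwDl ?sqr_ge0 ?exprn_gt0.
rewrite /powR sqrtr_eq0 leNgt N0 /= ln_sqrt ?ltW //.
by apply/eqP; rewrite eq_complex /=; apply/andP; split; apply/eqP; ring.
Qed.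

Lemma cpow_neq0 (x y : R) : 0 < x -> cpow (Complex x y) a != 0.
Proof.
move=> x0; rewrite cpowE // mulf_neq0 //.
  by rewrite eq_complex /= eqxx andbT expR_eq0.
rewrite eq_complex /=; apply/negP => /andP[/eqP c0 /eqP s0].
by have := cos2Dsin2 (a * atan (y / x)); rewrite c0 s0 expr0n /= addr0 => /eqP;
  rewrite eq_sym oner_eq0.
Qed.

(** The closed unit disc meets the line Re = 1 only at 1, so 1 - x lies in the open right
    half-plane. *)
Lemma Re_lt1 (x : C) : normc x <= 1 -> x != 1 -> complex.Re x < 1.
Proof.
move=> x1 xn1; rewrite lt_neqAle (le_trans _ (le_trans (Re_le_normc x) x1)) ?ler_norm // andbT.
apply: contra xn1 => /eqP; case: x x1 => u v /= h u1.
rewrite eq_complex /= u1 eqxx /=; move: h; rewrite u1 -(@ler_sqr R) ?nnegrE ?sqrtr_ge0 //.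
rewrite sqr_sqrtr ?addr_ge0 ?sqr_ge0 // expr1n gerDl => v2.
by rewrite -sqrf_eq0 eq_le v2 sqr_ge0.
Qed.


(** * Error of the binomial partial sums, by integration along a ray *)

Section Approximation.
Variables (x1 x2 : R).
Hypotheses (x1_lt1 : x1 < 1) (x_le1 : normc (Complex x1 x2) <= 1) (a_gt0 : 0 < a) (a_lt1 : a < 1).
Local Notation x := (Complex x1 x2).
Local Notation rX t := (1 - t * x1).
Local Notation rY t := (- (t * x2)).
Local Notation N t := (rX t ^+ 2 + rY t ^+ 2).
(** Lower bound on [0,1] for Re (1 - t x), which is affine in t with end values 1 and 1 - x1. *)
Let m := Num.min 1 (1 - x1).

Let m_gt0 : 0 < m. Proof. by rewrite lt_min ltr01 subr_gt0. Qed.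

Let m_le t : 0 <= t <= 1 -> m <= rX t.
Proof.
move=> /andP[t0 t1]; rewrite ge_min; have [x0|x0] := leP x1 0.
  by apply/orP; left; rewrite lerBrDr gerDl mulr_ge0_le0.
by apply/orP; right; rewrite lerB // ler_piMl // ltW.
Qed.

Let is_derive_lnN t : 0 < rX t ->
  is_derive t 1 (fun s => ln (N s) / 2) ((rX t * - x1 + rY t * - x2) / N t).
Proof.
move=> X0; have N0 : 0 < N t by rewrite ltr_pwDl ?sqr_ge0 ?exprn_gt0.
have DX : is_derive t 1 (fun s : R => rX s) (- x1).
  by apply: is_derive_eq; rewrite /GRing.scale /=; ring.
have DY : is_derive t 1 (fun s : R => rY s) (- x2).
  by apply: is_derive_eq; rewrite /GRing.scale /=; ring.
have DN := is_deriveD (is_deriveM DX DX) (is_deriveM DY DY).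
have DL := @is_derive1_comp R (@ln R) _ t _ _ (is_derive1_ln N0) DN.
have := is_deriveZ 2^-1 DL; have -> : (2^-1 \*: (@ln R \o (fun s => rX s * rX s + rY s * rY s))) = (fun s => ln (N s) / 2).
  by apply/funext => s; rewrite !expr2; exact: mulrC.
move=> D; apply: is_derive_eq D _; rewrite /GRing.scale /=.
have N1 : N t != 0 by rewrite gt_eqF.
by field.
Qed.

Let is_derive_atanYX t : 0 < rX t ->
  is_derive t 1 (fun s => atan (rY s / rX s)) ((- x2 * rX t - rY t * - x1) / N t).
Proof.
move=> X0; have N0 : 0 < N t by rewrite ltr_pwDl ?sqr_ge0 ?exprn_gt0.
have X1 : rX t != 0 by rewrite gt_eqF.
have DX : is_derive t 1 (fun s : R => rX s) (- x1).
  by apply: is_derive_eq; rewrite /GRing.scale /=; ring.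
have DY : is_derive t 1 (fun s : R => rY s) (- x2).
  by apply: is_derive_eq; rewrite /GRing.scale /=; ring.
have DQ := is_deriveM DY (@is_deriveV R (fun s => rX s) t _ 1 X1 DX).
have D := @is_derive1_comp R (@atan R) _ t _ _ (is_derive1_atan _) DQ.
apply: is_derive_eq D _; rewrite /GRing.scale /=.
have N1 : N t != 0 by rewrite gt_eqF.
rewrite [X in (1 + X ^+ 2)^-1](_ : _ = rY t / rX t) //.
move: (rX t) (rY t) X1 N1 => p q p0 pq0; field.
by rewrite p0 pq0.
Qed.

(** The t-derivative of C_n(t x) (1 - t x)^(- a), with the factor (1 - t x)^(- a) taken out. *)
Let E t n := a%:C * (dcoef a n)%:C * x * (t%:C * x) ^+ n / (1 - t%:C * x).

Let rayE t : 1 - t%:C * x = Complex (rX t) (rY t).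
Proof. by apply/eqP; rewrite eq_complex /=; apply/andP; split; apply/eqP; ring. Qed.

Let ray_neq0 t : 0 < rX t -> 1 - t%:C * x != 0.
Proof. by move=> X0; rewrite rayE eq_complex /= gt_eqF. Qed.

(** The two real derivatives assemble into the logarithmic derivative of 1 - t x. *)
Let logderivE t : 0 < rX t ->
  Complex ((rX t * - x1 + rY t * - x2) / N t) ((- x2 * rX t - rY t * - x1) / N t) =
  - x / (1 - t%:C * x).
Proof.
move=> X0; apply: (mulIf (ray_neq0 X0)); rewrite divfK ?ray_neq0 // rayE.
have N0 : N t != 0 by rewrite gt_eqF // ltr_pwDl ?sqr_ge0 ?exprn_gt0.
move: (rX t) (rY t) N0 => p q N0.
by apply/eqP; rewrite eq_complex /=; apply/andP; split; apply/eqP; field.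
Qed.

Let normc_E t n : 0 <= t <= 1 -> normc (E t n) <= a * dcoef a n / m.
Proof.
move=> t01; have Xm := m_le t01; have /andP[t0 t1] := t01.
have X0 : 0 < rX t by exact: lt_le_trans Xm.
rewrite !Normc.normcM !normc_real gtr0_norm // gtr0_norm ?dcoef_gt0 //.
rewrite -!mulrA ler_wpM2l ?(ltW a_gt0) // ler_wpM2l ?(ltW (dcoef_gt0 a_lt1 _)) //.
rewrite mulrA; apply: (@le_trans _ _ (1 * normc (1 - t%:C * x)^-1)).
  rewrite ler_wpM2r ?normc_ge0 // mulr_ile1 ?normc_ge0 // normcX exprn_ile1 ?normc_ge0 //.
  by rewrite Normc.normcM mulr_ile1 ?normc_ge0 // normc_real ger0_norm.
rewrite mul1r Normc.normcV lef_pV2 ?posrE //.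
  by apply: le_trans Xm (le_trans (ler_norm _) _); rewrite rayE;
    exact: (Re_le_normc (Complex (rX t) (rY t))).
by apply: lt_le_trans X0 (le_trans (ler_norm _) _); rewrite rayE;
  exact: (Re_le_normc (Complex (rX t) (rY t))).
Qed.

Let logP t := (rX t * - x1 + rY t * - x2) / N t.
Let argP t := (- x2 * rX t - rY t * - x1) / N t.

Let ray_ode n U V t :
  (Cpoly n).[t%:C * x] = Complex U V ->
  forall dU dV, x * (deriv (Cpoly n)).[t%:C * x] = Complex dU dV -> 0 < rX t ->
  Complex (dU - a * (logP t * U - argP t * V)) (dV - a * (logP t * V + argP t * U)) =
  E t n.
Proof.
move=> hC dU dV hD X0.
transitivity (Complex dU dV - a%:C * Complex (logP t) (argP t) * Complex U V).
  by apply/eqP; rewrite eq_complex /=; apply/andP; split; apply/eqP; ring.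
rewrite -hC -hD logderivE //; apply: (mulIf (ray_neq0 X0)); rewrite /E divfK ?ray_neq0 //.
have := congr1 (fun p => p.[t%:C * x]) (Cpoly_ode n).
rewrite !(hornerD, hornerM, hornerN, hornerC, hornerX, hornerXn) rmorphM /=.
have := ray_neq0 X0; move: (t%:C * x) => z.
move: (deriv (Cpoly n)).[z] (Cpoly n).[z] => c' c z1 ode.
transitivity (x * ((1 - z) * c' + a%:C * c)); last by rewrite ode; ring.
by field.
Qed.

Let rotation_bound (du dv L th B M : R) : 0 <= B ->
  normc (Complex du dv) <= B -> expR (- (a * L)) <= M ->
  `|expR (- (a * L)) * (du * cos th + dv * sin th)| <= M * (2 * B).
Proof.
move=> B0 hB hM; rewrite normrM gtr0_norm ?expR_gt0 // ler_pM ?expR_ge0 //.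
have cs y z : `|z| <= 1 -> `|y| <= normc (Complex du dv) -> `|y * z| <= B.
  move=> z1 yB; rewrite normrM -(mulr1 B) ler_pM //; exact: le_trans yB hB.
rewrite mulr_natl mulr2n; apply: le_trans (ler_normD _ _) (lerD _ _); apply: cs.
- by rewrite ler_norml cos_geN1 cos_le1.
- exact: (Re_le_normc (Complex du dv)).
- by rewrite ler_norml sin_geN1 sin_le1.
- exact: (Im_le_normc (Complex du dv)).
Qed.

(* With [G t = C_n (t x) (1 - t x) ^ (- a)], the differential equation of the
   partial sum [C_n] gives [G' t = a d_n x (t x) ^ n (1 - t x) ^ (- a - 1)]. *)
Lemma cpow_approx : exists K, forall n,
  normc ((Cpoly n).[x] - cpow (1 - x) a) <= K * dcoef a n.
Proof.
pose M := expR (- (a * (ln (m ^+ 2) / 2))).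
(* The inner 2 comes from the cosine and sine terms, the outer 2 from the real and imaginary parts,
   and the modulus in front from multiplying back by (1 - x)^a. *)
exists (normc (cpow (1 - x) a) * (2 * (M * (2 * (a / m))))) => n.
have [U [V h]] := horner_ray (Cpoly n) x.
pose L t := ln (N t) / 2; pose th t := atan (rY t / rX t).
pose G (u v : R -> R) t :=
  expR (- (a * L t)) * (u t * cos (a * th t) + v t * sin (a * th t)).
have X0 (t : R) : 0 <= t <= 1 -> 0 < rX t by move=> /m_le; exact: lt_le_trans.
have B0 : 0 <= a * dcoef a n / m.
  by rewrite divr_ge0 ?mulr_ge0 ?(ltW (dcoef_gt0 a_lt1 _)) // ltW.
have hM (t : R) : 0 <= t <= 1 -> expR (- (a * L t)) <= M.
  move=> t01; rewrite ler_expR lerN2 ler_pM2l // ler_pM2r ?invr_gt0 // ler_ln ?posrE ?exprn_gt0 //.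
    apply: (@le_trans _ _ (rX t ^+ 2)); last by rewrite lerDl sqr_ge0.
    by rewrite ler_sqr ?nnegrE ?(ltW m_gt0) ?(ltW (X0 _ t01)) // m_le.
  by rewrite ltr_pwDl ?sqr_ge0 ?exprn_gt0 // X0.
pose dU t := (deriv U).[t] - a * (logP t * U.[t] - argP t * V.[t]).
pose dV t := (deriv V).[t] - a * (logP t * V.[t] + argP t * U.[t]).
have EdUV (t : R) : 0 <= t <= 1 -> Complex (dU t) (dV t) = E t n.
  by move=> t01; have [h1 h2] := h t; exact: ray_ode h1 _ _ h2 (X0 _ t01).
have step (u v du dv : R -> R) :
    (forall t : R, 0 <= t <= 1 -> is_derive t 1 (G u v)
       (expR (- (a * L t)) * (du t * cos (a * th t) + dv t * sin (a * th t)))) ->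
    (forall t : R, 0 <= t <= 1 -> normc (Complex (du t) (dv t)) <= a * dcoef a n / m) ->
    `|G u v 1 - G u v 0| <= M * (2 * (a * dcoef a n / m)).
  move=> D bnd.
  have [||c c01 ->] := @MVT R (G u v) (fun t => expR (- (a * L t)) * (du t * cos (a * th t) + dv t * sin (a * th t))) 0 1 ltr01.
  - move=> t; rewrite in_itv /= => /andP[t0 t1]; apply: D.
    by rewrite !ltW.
  - apply: continuous_in_subspaceT => t /[!inE] /=; rewrite in_itv /= => t01.
    by apply/differentiable_continuous/derivable1_diffP; have [] := D t t01.
  - have c01' : 0 <= c <= 1 by move: c01; rewrite in_itv /= => /andP[? ?]; rewrite !ltW.
    by rewrite subr0 mulr1 rotation_bound ?bnd // hM.
have D1 : forall t : R, 0 <= t <= 1 -> is_derive t 1 (G (horner U) (horner V))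
       (expR (- (a * L t)) * (dU t * cos (a * th t) + dV t * sin (a * th t))).
  move=> t t01; apply: is_derive_rotation.
  - exact: is_derive_lnN (X0 _ t01).
  - exact: is_derive_atanYX (X0 _ t01).
(* The imaginary part is handled as the real part for the pair (V, - U). *)
have D2 : forall t : R, 0 <= t <= 1 -> is_derive t 1 (G (horner V) (fun s => - U.[s]))
       (expR (- (a * L t)) * (dV t * cos (a * th t) + - dU t * sin (a * th t))).
  move=> t t01.
  have := @is_derive_rotation (horner V) (fun s => - U.[s]) L th t _ (- (deriv U).[t]) _ _
    _ _ (is_derive_lnN (X0 _ t01)) (is_derive_atanYX (X0 _ t01)).
  move=> D; apply: is_derive_eq (D _ _ _) _.
  by rewrite /dU /dV /logP /argP; ring.
have b1 := step _ _ _ _ D1; have b2 := step _ _ _ _ D2.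
have {}b1 : `|G (horner U) (horner V) 1 - 1| <= M * (2 * (a * dcoef a n / m)).
  have : G (horner U) (horner V) 0 = 1.
    rewrite /G /L /th !(mul0r, oppr0, addr0, atan0, mulr0, cos0, sin0) expr0n /= addr0.
    rewrite expr1n ln1 mul0r mulr0 oppr0 expR0.
    have [+ _] := h 0; rewrite mul0r horner_coef0 coef_poly /= => -[<- _].
    by rewrite !(mul1r, mulr1, mulr0, addr0).
  move=> G0; rewrite -[X in `|_ - X|]G0.
  by apply: b1 => t t01; rewrite EdUV // normc_E.
have {}b2 : `|G (horner V) (fun s => - U.[s]) 1| <= M * (2 * (a * dcoef a n / m)).
  have G0 : G (horner V) (fun s => - U.[s]) 0 = 0.
    rewrite /G /L /th !(mul0r, oppr0, addr0, atan0, mulr0, cos0, sin0).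
    have [+ _] := h 0; rewrite mul0r horner_coef0 coef_poly /= => -[_ <-].
    by rewrite !(mul0r, mulr0, addr0).
  rewrite -[X in `|X|]subr0 -[X in `|_ - X|]G0; apply: b2 => t t01.
  by apply: le_trans (normc_E n t01); rewrite -EdUV //= sqrrN addrC.
have E1 : 1 - x = Complex (rX 1) (rY 1) by rewrite -rayE mul1r.
have X1 : 0 < rX 1 by apply: X0; rewrite ler01 lexx.
have -> : (Cpoly n).[x] = cpow (1 - x) a *
    Complex (G (horner U) (horner V) 1) (G (horner V) (fun s => - U.[s]) 1).
  have [+ _] := h 1; rewrite mul1r => ->; rewrite E1 cpowE // /G -/(L 1) -/(th 1).
  have := cos2Dsin2 (a * th 1); have : expR (a * L 1) * expR (- (a * L 1)) = 1.
    exact: expRxMexpNx_1.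
  move: (expR _) (expR _) (cos _) (sin _) (U.[_]) (V.[_]) => e e' c s u v ee cs.
  apply/eqP; rewrite eq_complex /=; apply/andP; split; apply/eqP.
    transitivity (u * (e' * e) * (c ^+ 2 + s ^+ 2)); last by ring.
    by rewrite ee cs !mulr1.
  transitivity (v * (e' * e) * (c ^+ 2 + s ^+ 2)); last by ring.
  by rewrite ee cs !mulr1.
rewrite -{2}[cpow _ _]mulr1 -mulrBr Normc.normcM -mulrA ler_wpM2l ?normc_ge0 //.
apply: le_trans (normc_le_ReIm _) _; rewrite /= subr0.
apply: le_trans (lerD b1 b2) _.
by rewrite le_eqVlt; apply/orP; left; apply/eqP; ring.
Qed.

End Approximation.

End PrincipalPower.

(** * Formal power series *)

(** A separate name for sequences, which then carry the convolution product as their ring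
    structure. *)
Definition pser (K : comNzRingType) := nat -> K.

Section PowerSeries.
Variable K : comNzRingType.
Implicit Types a b c : pser K.

HB.instance Definition _ := GRing.Zmodule.copy (pser K) (nat -> K).

Definition pmul a b : pser K := fun n => \sum_(j < n.+1) a j * b (n - j)%N.
Definition pone : pser K := fun n => (n == 0)%:R.
Definition ptrunc m a : {poly K} := \poly_(i < m.+1) a i.

Lemma ptruncE m a k : (k <= m)%N -> (ptrunc m a)`_k = a k.
Proof. by move=> km; rewrite coef_poly ltnS km. Qed.

(** Coefficients up to m depend only on truncations, so the ring laws are inherited from
    polynomials. *)
Lemma pmulE m a b k : (k <= m)%N -> pmul a b k = (ptrunc m a * ptrunc m b)`_k.
Proof.
move=> km; rewrite coefM; apply: eq_bigr => j _.
by rewrite !ptruncE // (leq_trans _ km) ?leq_subr // -ltnS.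
Qed.

Lemma pmulC : commutative pmul.
Proof. by move=> a b; apply/funext => n; rewrite !(@pmulE n) // mulrC. Qed.

Lemma pmulA : associative pmul.
Proof.
suff E a b c n : pmul (pmul a b) c n = ((ptrunc n a * ptrunc n b) * ptrunc n c)`_n.
  by move=> a b c; apply/funext => n; rewrite pmulC !E mulrC mulrA.
rewrite coefM; apply: eq_bigr => j _.
by rewrite (@pmulE n) ?ptruncE ?leq_subr // -ltnS.
Qed.

Lemma pmul1 : left_id pone pmul.
Proof.
move=> a; apply/funext => n; rewrite /pmul big_ord_recl /= mul1r subn0 big1 ?addr0 // => i _.
by rewrite mul0r.
Qed.

Lemma pmulDl : left_distributive pmul +%R.
Proof.
move=> a b c; apply/funext => n; transitivity (pmul a c n + pmul b c n) => //.
by rewrite /pmul -big_split; apply: eq_bigr => i _; exact: mulrDl.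
Qed.

Lemma pone_neq0 : pone != 0.
Proof.
by apply/eqP => /(congr1 (fun f : pser K => f 0)) /eqP; rewrite /pone /= oner_eq0.
Qed.

HB.instance Definition _ :=
  GRing.Zmodule_isComNzRing.Build (pser K) pmulA pmulC pmul1 pmulDl pone_neq0.

Lemma pserM a b n : (a * b) n = \sum_(j < n.+1) a j * b (n - j)%N.
Proof. by []. Qed.

Lemma pserD a b n : (a + b) n = a n + b n. Proof. by []. Qed.
Lemma pserN a n : (- a) n = - a n. Proof. by []. Qed.
Lemma pser1 n : (1 : pser K) n = (n == 0)%:R. Proof. by []. Qed.

Definition pser_of_poly (p : {poly K}) : pser K := fun i => p`_i.

Lemma pser_of_polyM p q : pser_of_poly (p * q) = pser_of_poly p * pser_of_poly q.
Proof. by apply/funext => n; rewrite /pser_of_poly coefM. Qed.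

Lemma pser_of_polyB p q : pser_of_poly (p - q) = pser_of_poly p - pser_of_poly q.
Proof. by apply/funext => n; rewrite /pser_of_poly coefB. Qed.

Lemma pser_of_poly1 : pser_of_poly 1 = 1.
Proof. by apply/funext => n; rewrite /pser_of_poly coef1. Qed.

Lemma pser_of_polyX p n : pser_of_poly (p ^+ n) = pser_of_poly p ^+ n.
Proof.
by elim: n => [|n IH]; [exact: pser_of_poly1|rewrite !exprS pser_of_polyM IH].
Qed.

(** Substitution of r X for X. *)
Definition pscale (r : K) a : pser K := fun n => a n * r ^+ n.

Lemma pscaleM r a b : pscale r (a * b) = pscale r a * pscale r b.
Proof.
apply/funext => n; rewrite /pscale !pserM mulr_suml; apply: eq_bigr => i _.
by rewrite mulrACA -exprD subnKC // -ltnS.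
Qed.

Lemma pscaleD r a b : pscale r (a + b) = pscale r a + pscale r b.
Proof. by apply/funext => n; rewrite /pscale !pserD mulrDl. Qed.

Lemma pscale1 r : pscale r 1 = 1.
Proof.
by apply/funext => -[|n]; rewrite /pscale pser1 ?expr0 ?mulr1 // mul0r.
Qed.

Lemma pscaleX r a n : pscale r (a ^+ n) = pscale r a ^+ n.
Proof.
by elim: n => [|n IH]; [exact: pscale1|rewrite !exprS pscaleM IH].
Qed.

Definition pconst (r : K) : pser K := fun n => if n is 0 then r else 0.

Lemma pconstM r a n : (pconst r * a) n = r * a n.
Proof.
rewrite pserM big_ord_recl /= subn0 big1 ?addr0 // => i _.
by rewrite mul0r.
Qed.

Definition pX : pser K := fun n => (n == 1)%:R.

Lemma pXM a n : (pX * a) n = if n is m.+1 then a m else 0.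
Proof.
rewrite pserM; case: n => [|n]; first by rewrite big_ord1 mul0r.
rewrite big_ord_recl mul0r add0r big_ord_recl /= mul1r subSS subn0 big1 ?addr0 // => i _.
by rewrite mul0r.
Qed.

End PowerSeries.

(** * Absolutely summable series *)

Section Summable.
Variable R : realType.
Local Notation C := R[i].
Local Notation normc := (@Normc.normc R).
Implicit Types (a b u : pser C) (B K L U : R).

Lemma normc_sum (I : Type) (r : seq I) (P : pred I) (F : I -> C) :
  normc (\sum_(i <- r | P i) F i) <= \sum_(i <- r | P i) normc (F i).
Proof.
elim/big_ind2: _ => [|x x' y y' h1 h2|i _]; first by rewrite Normc.normc0.
  by apply: le_trans (le_normcD _ _) _; exact: lerD.
exact: lexx.
Qed.

(** The l1 norm is at most K. Bounding all partial sums avoids forming the infinite sum. *)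
Definition l1bound a K := forall n, \sum_(k < n) normc (a k) <= K.
Definition supbound u U := forall n, normc (u n) <= U.
Definition null_seq u := forall e, 0 < e -> exists n0, forall n, (n0 <= n)%N -> normc (u n) < e.

Lemma l1bound_ge0 a K : l1bound a K -> 0 <= K.
Proof. by move=> /(_ 0); rewrite big_ord0. Qed.

Lemma l1bound1 : l1bound 1 1.
Proof.
case=> [|n]; first by rewrite big_ord0.
by rewrite big_ord_recl big1 ?addr0 ?Normc.normc1 // => i _; rewrite Normc.normc0.
Qed.

Lemma l1boundD a b K L : l1bound a K -> l1bound b L -> l1bound (a + b) (K + L).
Proof.
move=> ha hb n; apply: le_trans (lerD (ha n) (hb n)).
by rewrite -big_split; apply: ler_sum => i _; exact: le_normcD.
Qed.

Lemma sum_conv (f g : nat -> R) n :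
  \sum_(k < n) \sum_(j < k.+1) f j * g (k - j)%N =
  \sum_(j < n) f j * \sum_(i < n - j) g i.
Proof.
elim: n => [|n IH]; first by rewrite !big_ord0.
rewrite big_ord_recr IH [RHS]big_ord_recr /= subSnn big_ord1.
rewrite big_ord_recr /= subnn addrA -big_split /=; congr (_ + _).
by apply: eq_bigr => j _; rewrite subSn ?(ltnW (ltn_ord j)) // big_ord_recr mulrDr.
Qed.

Lemma l1boundM a b K L : l1bound a K -> l1bound b L -> l1bound (a * b) (K * L).
Proof.
move=> ha hb n.
apply: (@le_trans _ _ (\sum_(k < n) \sum_(j < k.+1) normc (a j) * normc (b (k - j)%N))).
  apply: ler_sum => k _; rewrite pserM; apply: le_trans (normc_sum _ _ _) _.
  by apply: ler_sum => j _; rewrite Normc.normcM.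
rewrite (sum_conv (fun j => normc (a j)) (fun j => normc (b j))).
apply: (@le_trans _ _ (\sum_(j < n) normc (a j) * L)).
  by apply: ler_sum => j _; rewrite ler_wpM2l ?normc_ge0 // hb.
by rewrite -mulr_suml ler_wpM2r ?(l1bound_ge0 hb) // ha.
Qed.

Lemma l1boundX a K n : l1bound a K -> l1bound (a ^+ n) (K ^+ n).
Proof.
move=> ha; elim: n => [|n IH]; first exact: l1bound1.
by rewrite !exprS; exact: l1boundM.
Qed.

Lemma l1bound_le a K L : K <= L -> l1bound a K -> l1bound a L.
Proof. by move=> KL ha n; exact: le_trans (ha n) KL. Qed.

Lemma l1bound_poly (p : {poly C}) : exists K, l1bound (pser_of_poly p) K.
Proof.
exists (\sum_(k < size p) normc p`_k) => n; case: (leqP n (size p)) => h.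
  rewrite -(subnKC h) big_split_ord /= lerDl sumr_ge0 // => i _.
  exact: normc_ge0.
rewrite -(subnKC (ltnW h)) big_split_ord /= gerDl.
by rewrite big1 // => i _; rewrite /pser_of_poly nth_default ?Normc.normc0 // leq_addr.
Qed.

Lemma supboundM a u K U : l1bound a K -> supbound u U -> supbound (a * u) (K * U).
Proof.
move=> ha hu n; rewrite pserM; apply: le_trans (normc_sum _ _ _) _.
have U0 : 0 <= U by exact: le_trans (normc_ge0 _) (hu 0).
apply: (@le_trans _ _ (\sum_(j < n.+1) normc (a j) * U)).
  by apply: ler_sum => j _; rewrite Normc.normcM ler_wpM2l ?normc_ge0 // hu.
by rewrite -mulr_suml ler_wpM2r // ha.
Qed.

Lemma null_seq_supbound u : null_seq u -> exists U, supbound u U.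
Proof.
move=> /(_ 1 ltr01)[n0 h]; exists (1 + \sum_(k < n0) normc (u k)) => n.
have S0 : 0 <= \sum_(k < n0) normc (u k) by rewrite sumr_ge0 // => i _; exact: normc_ge0.
case: (leqP n0 n) => hn; first by rewrite (le_trans (ltW (h n hn))) // lerDl.
rewrite (bigD1 (Ordinal hn)) //= addrCA lerDl addr_ge0 // sumr_ge0 // => i _.
exact: normc_ge0.
Qed.

(** Choose n0 so that the partial sum up to n0 is within e of the supremum of all of them. *)
Lemma l1bound_tail a K e : l1bound a K -> 0 < e ->
  exists n0, forall n, \sum_(k < n | (n0 <= k)%N) normc (a k) <= e.
Proof.
move=> ha e0; pose S := [set \sum_(k < n) normc (a k) | n in [set: nat]].
have Ssup : has_sup S.
  by split; [exists 0, 0 => //; rewrite big_ord0 | exists K => _ [n _ <-]].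
have [_ [n0 _ <-] hn0] := sup_adherent e0 Ssup.
exists n0 => n; case: (leqP n n0) => hn.
  by rewrite big_pred0 ?ltW // => i; apply/negbTE; rewrite -ltnNge (leq_trans _ hn).
have : \sum_(k < n) normc (a k) <= sup S by apply: sup_upper_bound => //; exists n.
rewrite (bigID (fun k : 'I_n => (n0 <= k)%N)) /= => h.
have E : \sum_(k < n | ~~ (n0 <= k)%N) normc (a k) = \sum_(k < n0) normc (a k).
  rewrite -(subnKC (ltnW hn)) big_split_ord /= addrC big_pred0 ?add0r.
    by apply: eq_bigl => i; rewrite -ltnNge ltn_ord.
  by move=> i; rewrite leq_addr.
by move: h hn0; rewrite E; lra.
Qed.

(** The convolution is split at an index n1: below it u is evaluated far out and is small, above it
    the tail of a is small and u is bounded. Adding 1 to K and U keeps the divisors positive. *)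
Lemma null_seqM a u K : l1bound a K -> null_seq u -> null_seq (a * u).
Proof.
move=> ha hu e e0; have [U hU] := null_seq_supbound hu.
have K0 := l1bound_ge0 ha.
have U0 : 0 <= U by exact: le_trans (normc_ge0 _) (hU 0).
have K1 : 0 < K + 1 by rewrite ltr_wpDl.
have U1 : 0 < U + 1 by rewrite ltr_wpDl.
have e1 : 0 < e / 2 / (K + 1) by rewrite !divr_gt0.
have e2 : 0 < e / 2 / (U + 1) by rewrite !divr_gt0.
have [n1 h1] := l1bound_tail ha e2; have [n2 h2] := hu _ e1.
exists (n1 + n2)%N => n hn; rewrite pserM; apply: le_lt_trans (normc_sum _ _ _) _.
apply: (@le_lt_trans _ _ (\sum_(j < n.+1) normc (a j) * (e / 2 / (K + 1)) +
                          \sum_(j < n.+1 | (n1 <= j)%N) normc (a j) * U)).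
  rewrite [X in _ <= _ + X]big_mkcond -big_split; apply: ler_sum => j _ /=.
  rewrite Normc.normcM; case: ifPn => hj.
    by rewrite -mulrDr ler_wpM2l ?normc_ge0 // (le_trans (hU _)) // lerDr ltW.
  rewrite addr0 ler_wpM2l ?normc_ge0 // ltW // h2 //.
  by rewrite -ltnNge in hj; rewrite leq_subRL; [lia|have := ltn_ord j; lia].
rewrite -!mulr_suml.
have A : (\sum_(j < n.+1) normc (a j)) * (e / 2 / (K + 1)) < e / 2.
  rewrite mulrA ltr_pdivrMr // mulrC ltr_pM2l ?divr_gt0 //.
  by apply: le_lt_trans (ha _) _; rewrite ltrDl.
have B : (\sum_(j < n.+1 | (n1 <= j)%N) normc (a j)) * U <= e / 2.
  apply: le_trans (ler_wpM2r U0 (h1 _)) _.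
  by rewrite mulrAC ler_pdivrMr // ler_wpM2l ?divr_ge0 ?ltW // ltrDl.
lra.
Qed.

Lemma null_seqD u v : null_seq u -> null_seq v -> null_seq (u + v).
Proof.
move=> hu hv e e0; have e2 : 0 < e / 2 by rewrite divr_gt0.
have [n1 h1] := hu _ e2; have [n2 h2] := hv _ e2.
exists (maxn n1 n2) => n; rewrite geq_max => /andP[/h1 k1 /h2 k2].
by apply: le_lt_trans (le_normcD _ _) _; rewrite [e]splitr ltrD.
Qed.

End Summable.

(** * Wiener's lemma on the disc *)

Section Newman.
Variable R : realType.
Local Notation C := R[i].
Local Notation normc := (@Normc.normc R).
Local Notation "x %:C" := (real_complex R x) : ring_scope.
Implicit Types (p : {poly C}) (h e y u : pser C).

Lemma prim_root_exists n : (0 < n)%N -> exists w : C, n.-primitive_root w.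
Proof.
move=> n0; have [r Dp] := closed_field_poly_normal ('X^n - 1 : {poly C}).
rewrite (monicP _) ?monicXnsubC // scale1r in Dp.
suff /hasP[w _ hw] : has n.-primitive_root r by exists w.
apply: has_prim_root => //.
- by apply/allP => z; rewrite -root_prod_XsubC -Dp.
- by rewrite -separable_prod_XsubC -Dp separable_Xn_sub_1 // pnatr_eq0 -lt0n.
- by rewrite -ltnS -(size_prod_XsubC r id) -Dp size_XnsubC.
Qed.

Lemma normc_prim_root n (w : C) : (0 < n)%N -> n.-primitive_root w -> normc w = 1.
Proof.
move=> n0 /prim_expr_order /(congr1 normc); rewrite normcX Normc.normc1 => /eqP.
by rewrite pexpr_eq1 ?normc_ge0 // => /eqP.
Qed.

(** Cauchy's estimate, with the contour integral replaced by the average over the n-th roots of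
    unity, n exceeding k and at least the size of p. *)
Lemma normc_coef_le p B k :
  (forall z, normc z = 1 -> normc p.[z] <= B) -> normc p`_k <= B.
Proof.
move=> hB; have B0 : 0 <= B.
  by apply: le_trans (normc_ge0 _) (hB 1 _); exact: Normc.normc1.
pose n := maxn (size p) k.+1; have n0 : (0 < n)%N by rewrite leq_max orbT.
have kn : (k < n)%N by rewrite leq_max leqnn orbT.
have [w hw] := prim_root_exists n0; have w1 := normc_prim_root n0 hw.
have wn := prim_expr_order hw.
have w0 : w != 0.
  by apply/eqP => w0; move: w1; rewrite w0 Normc.normc0 => /eqP; rewrite eq_sym oner_eq0.
have S : \sum_(j < n) p.[w ^+ j] / (w ^+ j) ^+ k = n%:R * p`_k.
  under eq_bigr => j _ do rewrite (@horner_coef_wide _ n) ?leq_maxl // mulr_suml.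
  rewrite exchange_big /= (bigD1 (Ordinal kn)) //= [X in _ + X]big1 ?addr0.
    rewrite (eq_bigr (fun=> p`_k)) ?sumr_const ?card_ord ?mulr_natl // => j _.
    by rewrite mulfK // expf_neq0 // expf_neq0.
  (* For i different from k the sum over j is geometric with ratio z != 1 and z^n = 1, hence 0. *)
  move=> i ik; pose z := w ^+ i / w ^+ k.
  have z1 : z - 1 != 0.
    rewrite subr_eq0; apply: contra ik => /eqP z1; apply/eqP/val_inj => /=.
    apply/eqP; rewrite -(modn_small kn) -(modn_small (ltn_ord i)) eq_sym.
    rewrite eq_sym -(eq_prim_root_expr hw) -subr_eq0.
    have -> : w ^+ i = z * w ^+ k by rewrite /z divfK // expf_neq0.
    by rewrite z1 mul1r subrr.
  have zn : z ^+ n = 1.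
    by rewrite /z expr_div_n -!exprM !(mulnC _ n) !exprM wn !expr1n divr1.
  rewrite (eq_bigr (fun j : 'I_n => p`_i * z ^+ j)).
    rewrite -mulr_sumr; apply/eqP; rewrite mulf_eq0; apply/orP; right.
    by rewrite -(inj_eq (mulfI z1)) mulr0 -subrX1 zn subrr.
  by move=> j _; rewrite /z expr_div_n -!exprM ![(_ * j)%N]mulnC mulrA.
have nR : 0 < n%:R :> R by rewrite ltr0n.
rewrite -(ler_pM2l nR) -{1}(normr_nat R n) -normc_real rmorph_nat -Normc.normcM -S.
apply: le_trans (normc_sum _ _ _) _.
rewrite mulr_natl -[n in _ *+ n]card_ord -sumr_const; apply: ler_sum => j _.
rewrite Normc.normcM Normc.normcV !normcX w1 !expr1n invr1 mulr1 hB //.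
by rewrite normcX w1 expr1n.
Qed.

Lemma normc_horner_le p K z : l1bound (pser_of_poly p) K -> normc z <= 1 ->
  normc p.[z] <= K.
Proof.
move=> hK z1; rewrite horner_coef; apply: le_trans (normc_sum _ _ _) _.
apply: le_trans (hK (size p)); apply: ler_sum => i _.
by rewrite Normc.normcM normcX ler_piMr ?normc_ge0 // exprn_ile1 ?normc_ge0.
Qed.

Lemma geometric_le (q : R) n : 0 <= q -> q < 1 -> \sum_(k < n) q ^+ k <= (1 - q)^-1.
Proof.
move=> q0 q1; have d0 : 0 < 1 - q by rewrite subr_gt0.
rewrite -(ler_pM2l d0) mulfV ?gt_eqF // -opprB mulNr -subrX1 opprB gerBl.
exact: exprn_ge0.
Qed.

Lemma XsubC_inverse (r : C) : 1 < normc r ->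
  exists h K, pser_of_poly ('X - r%:P) * h = 1 /\ l1bound h K.
Proof.
move=> r1; have r0 : r != 0.
  by apply: contraTneq r1 => ->; rewrite Normc.normc0 ltr10.
pose q := (normc r)^-1; have q0 : 0 <= q by rewrite invr_ge0 normc_ge0.
have q1 : q < 1 by rewrite invf_lt1 // (lt_trans ltr01).
exists (fun k => - r^-1 ^+ k.+1), (1 - q)^-1; split.
  have -> : pser_of_poly ('X - r%:P) = @pX C - pconst r.
    apply/funext => k; rewrite /pser_of_poly coefB coefX coefC pserD pserN /pX /pconst.
    by case: k.
  rewrite mulrBl; apply/funext => n; rewrite pserD pserN pXM pconstM pser1.
  case: n => [|n] /=; first by rewrite expr1 mulrN opprK add0r mulfV.
  by rewrite mulrN opprK [r^-1 ^+ n.+2]exprS mulrA mulfV // mul1r addNr.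
move=> n; apply: le_trans (geometric_le n q0 q1); apply: ler_sum => k _.
by rewrite normcN normcX Normc.normcV exprS ler_piMl ?exprn_ge0 // ltW.
Qed.

(** All roots lie outside the closed disc, so each linear factor is inverted by a geometric
    series. *)
Lemma poly_inverse p : (forall z, normc z <= 1 -> p.[z] != 0) ->
  exists h K, pser_of_poly p * h = 1 /\ l1bound h K.
Proof.
move=> hp; have [rs Dp] := closed_field_poly_normal p.
have c0 : lead_coef p != 0.
  rewrite lead_coef_eq0; apply: contraTneq (hp 0 _) => [->|]; first by rewrite horner0 eqxx.
  by rewrite Normc.normc0.
have hrs : all (fun r => 1 < normc r) rs.
  apply/allP => r rrs; rewrite ltNge; apply/negP => /hp;
    rewrite Dp hornerZ mulf_eq0 negb_or.
  by rewrite -rootE root_prod_XsubC rrs andbF.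
have [h [K [hh hK]]] : exists h K,
    pser_of_poly (\prod_(z <- rs) ('X - z%:P)) * h = 1 /\ l1bound h K.
  elim: rs hrs {Dp} => [_|r rs IH /= /andP[/XsubC_inverse[h1 [K1 [e1 l1]]] /IH[h2 [K2 [e2 l2]]]]].
    by exists 1, 1; rewrite big_nil pser_of_poly1 mulr1; split=> //; exact: l1bound1.
  exists (h1 * h2), (K1 * K2); split; last exact: l1boundM.
  by rewrite big_cons pser_of_polyM mulrACA e1 e2 mulr1.
have [L hL] := l1bound_poly (lead_coef p)^-1%:P.
exists (pser_of_poly (lead_coef p)^-1%:P * h), (L * K); split; last exact: l1boundM.
rewrite {1}Dp -mul_polyC pser_of_polyM mulrACA hh mulr1 -pser_of_polyM -polyCM.
by rewrite mulfV // pser_of_poly1.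
Qed.

End Newman.

(** * Norms of powers of the inverse, and perturbation by a small series *)

Section NewmanInverse.
Variable R : realType.
Local Notation C := R[i].
Local Notation normc := (@Normc.normc R).
Local Notation "x %:C" := (real_complex R x) : ring_scope.
Implicit Types (p : {poly C}) (h e y u : pser C).

(** Cauchy's estimate for 1 / p. Since h is a series, it is truncated to a polynomial hm with p hm =
    1 + q and q of l1 norm at most P e; then e tends to 0. *)
Lemma inverse_coef_le p h (K b : R) : 0 < b -> pser_of_poly p * h = 1 -> l1bound h K ->
  (forall z, normc z = 1 -> b <= normc p.[z]) -> supbound h b^-1.
Proof.
move=> b0 ph hK hp k; have [P hP] := l1bound_poly p.
have P0 := l1bound_ge0 hP.
suff H (e : R) : 0 < e -> normc (h k) * b <= 1 + P * e.
  rewrite -div1r ler_pdivlMr //; apply/ler_addgt0Pr => e e0.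
  have e1 : 0 < e / (P + 1) by rewrite divr_gt0 // ltr_wpDl.
  apply: le_trans (H _ e1) _; rewrite lerD2l mulrCA ler_piMr ?(ltW e0) //.
  by rewrite ler_pdivrMr ?mul1r ?lerDl // ltr_wpDl.
move=> e0; have [n0 hn0] := l1bound_tail hK e0.
pose m := maxn n0 k; pose hm := ptrunc m h; pose q := p * hm - 1.
have hq : l1bound (pser_of_poly q) (P * e).
  pose t : pser C := fun j => if (j <= m)%N then 0 else h j.
  have hmt : pser_of_poly hm = h - t.
    apply/funext => j; rewrite /pser_of_poly coef_poly ltnS pserD pserN /t.
    by case: ifP => _; rewrite ?subr0 ?subrr.
  have -> : pser_of_poly q = pser_of_poly p * - t.
    rewrite pser_of_polyB pser_of_polyM pser_of_poly1 hmt mulrBr ph.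
    by ring.
  apply: l1boundM => // n; apply: le_trans (hn0 n).
  rewrite [leRHS]big_mkcond; apply: ler_sum => j _; rewrite pserN normcN /t.
  case: ifPn => jm; last by rewrite (leq_trans (leq_maxl n0 k)) // ltnW // ltnNge.
  by rewrite Normc.normc0; case: ifP => // _; exact: normc_ge0.
have -> : h k = hm`_k by rewrite ptruncE // leq_maxr.
rewrite -ler_pdivlMr //; apply: normc_coef_le => z z1.
rewrite ler_pdivlMr //; apply: (@le_trans _ _ (normc hm.[z] * normc p.[z])).
  by rewrite ler_wpM2l ?normc_ge0 // hp.
rewrite -Normc.normcM mulrC -hornerM.
have -> : p * hm = 1 + q by rewrite /q addrCA subrr addr0.
rewrite hornerD hornerC; apply: le_trans (le_normcD _ _) _.
by rewrite Normc.normc1 lerD2l normc_horner_le // z1.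
Qed.

Lemma expr1D_le (d : R) n : 0 <= d -> d <= 1 -> (1 + d) ^+ n <= 1 + 3 ^+ n * d.
Proof.
move=> d0 d1; elim: n => [|n IH]; first by rewrite !expr0 mul1r lerDl.
rewrite exprS; apply: le_trans (ler_wpM2l _ IH) _; first by lra.
have t1 : 1 <= 3 ^+ n :> R by rewrite exprn_ege1 // ler1n.
have t3 : 3 ^+ n.+1 = 3 * 3 ^+ n :> R by rewrite exprS.
rewrite t3; have h1 : d <= 3 ^+ n * d by rewrite ler_peMl.
have h2 : 3 ^+ n * d * d <= 3 ^+ n * d by rewrite ler_piMr // mulr_ge0 // exprn_ge0.
by move: h1 h2; set T := 3 ^+ n; nra.
Qed.

(** The margin b - c pays for the change of p when the disc is enlarged to a radius r > 1. *)
Lemma poly_min_dilate p (b c : R) : c < b -> (forall z, normc z <= 1 -> b <= normc p.[z]) ->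
  exists2 r : R, 1 < r & forall z, normc z <= 1 -> c <= normc p.[r%:C * z].
Proof.
move=> cb hp; have [P hP] := l1bound_poly p; have P0 := l1bound_ge0 hP.
pose s := size p; pose d := Num.min 1 ((b - c) / (3 ^+ s * (P + 1))).
have t0 : 0 < 3 ^+ s * (P + 1) :> R by rewrite mulr_gt0 ?exprn_gt0 // ltr_wpDl.
have d0 : 0 < d by rewrite lt_min ltr01 divr_gt0 // subr_gt0.
have d1 : d <= 1 by rewrite ge_min lexx.
exists (1 + d) => [|z z1]; first by rewrite ltrDl.
suff H : normc (p.[z] - p.[(1 + d)%:C * z]) <= b - c.
  have := le_normcD (p.[z] - p.[(1 + d)%:C * z]) p.[(1 + d)%:C * z].
  by rewrite subrK => h1; have := hp z z1; lra.
rewrite !horner_coef -sumrB; apply: le_trans (normc_sum _ _ _) _.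
have b1 : (3 ^+ s * d) * P <= b - c.
  apply: (@le_trans _ _ ((3 ^+ s * (P + 1)) * d)).
    rewrite -mulrA -[leRHS]mulrA ler_wpM2l ?exprn_ge0 // mulrC.
    by rewrite ler_wpM2r ?(ltW d0) // lerDl.
  by rewrite mulrC -ler_pdivlMr // /d ge_min lexx orbT.
apply: le_trans b1; rewrite [leRHS]mulrC.
apply: (@le_trans _ _ (\sum_(i < s) normc p`_i * (3 ^+ s * d))); last first.
  by rewrite -mulr_suml ler_wpM2r ?mulr_ge0 ?exprn_ge0 ?(ltW d0) // hP.
apply: ler_sum => i _; rewrite exprMn -mulrBr Normc.normcM ler_wpM2l ?normc_ge0 //.
have -> : z ^+ i - (1 + d)%:C ^+ i * z ^+ i = - (((1 + d) ^+ i - 1)%:C * z ^+ i).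
  by rewrite rmorphB rmorphXn /= rmorph1; ring.
have di : 1 <= (1 + d) ^+ i by rewrite exprn_ege1 // lerDl ltW.
rewrite normcN Normc.normcM normc_real ger0_norm ?subr_ge0 //.
apply: (@le_trans _ _ ((1 + d) ^+ i - 1)).
  by rewrite ler_piMr ?subr_ge0 // normcX exprn_ile1 ?normc_ge0.
rewrite lerBlDl; apply: le_trans (expr1D_le i (ltW d0) d1) _.
rewrite lerD2l ler_wpM2r ?(ltW d0) // ler_weXn2l ?ler1n //.
by rewrite ltnW // ltn_ord.
Qed.

(** On the larger disc, Cauchy's estimate bounds each coefficient of the n-th power by c^(-n).
    Returning to radius 1 multiplies the k-th one by r^(-k), so the sum costs the factor D = 1 / (1
    - 1/r), independent of n. *)
Lemma poly_inverse_power_l1 p (b c : R) : 0 < c -> c < b ->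
  (forall z, normc z <= 1 -> b <= normc p.[z]) ->
  exists q D, pser_of_poly p * q = 1 /\ forall n, l1bound (q ^+ n) (D * c^-1 ^+ n).
Proof.
move=> c0 cb hp; have [r r1 hr] := poly_min_dilate cb hp.
have r0 : 0 < r by exact: lt_trans r1.
have rn0 : r%:C != 0 by rewrite eq_complex /= eqxx andbT gt_eqF.
pose pr := \poly_(i < size p) (p`_i * r%:C ^+ i).
have prE z : pr.[z] = p.[r%:C * z].
  by rewrite horner_poly horner_coef; apply: eq_bigr => i _; rewrite exprMn mulrA.
have prS : pser_of_poly pr = pscale r%:C (pser_of_poly p).
  apply/funext => i; rewrite /pser_of_poly /pscale coef_poly; case: ltnP => // h.
  by rewrite nth_default ?mul0r.
have [|h [K [ph hK]]] := @poly_inverse R pr.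
  move=> z z1; rewrite prE; apply: contraTneq (hr z z1) => ->.
  by rewrite Normc.normc0 -ltNge.
exists (pscale r%:C^-1 h), ((1 - r^-1)^-1).
have rK a : pscale r%:C^-1 (pscale r%:C a) = a.
  by apply/funext => n; rewrite /pscale -mulrA -exprMn mulfV // expr1n mulr1.
split; first by rewrite -[pser_of_poly p]rK -pscaleM -prS ph pscale1.
move=> n; have hn : supbound (h ^+ n) ((c ^+ n)^-1).
  apply: (@inverse_coef_le (pr ^+ n) _ (K ^+ n)); first exact: exprn_gt0.
  - by rewrite pser_of_polyX -exprMn ph expr1n.
  - exact: l1boundX.
  - move=> z z1; rewrite horner_exp normcX lerXn2r ?nnegrE ?normc_ge0 ?(ltW c0) // prE.
    by rewrite hr // z1.
rewrite -pscaleX => k; rewrite exprVn.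
apply: (@le_trans _ _ (\sum_(i < k) r^-1 ^+ i * (c ^+ n)^-1)).
  apply: ler_sum => i _; rewrite /pscale Normc.normcM mulrC normcX Normc.normcV normc_real.
  by rewrite gtr0_norm // ler_wpM2l ?exprn_ge0 ?invr_ge0 ?(ltW r0) // hn.
rewrite -mulr_suml ler_wpM2r ?invr_ge0 ?exprn_ge0 ?(ltW c0) //.
by apply: geometric_le; rewrite ?invr_ge0 ?(ltW r0) // invf_lt1.
Qed.

Lemma half_exp_small (c d : R) : 0 < d -> exists n, c * 2^-1 ^+ n < d.
Proof.
move=> d0; have [c0|c0] := leP c 0.
  by exists 0; rewrite expr0 mulr1 (le_lt_trans c0).
pose n := (Num.truncn (c / d)).+1; exists n.
have h : c / d < n%:R by have /andP[_] := truncn_itv (ltW (divr_gt0 c0 d0)).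
rewrite exprVn ltr_pdivrMr ?exprn_gt0 // mulrC -ltr_pdivrMr //.
by apply: lt_trans h _; rewrite -natrX ltr_nat ltn_expl.
Qed.

(** Only coefficients of y up to n enter, so this applies before y is known to be bounded. *)
Lemma normc_conv_le a K y n : l1bound a K ->
  normc ((a * y) n) <= K * \sum_(k < n.+1) normc (y k).
Proof.
move=> ha; rewrite pserM; apply: le_trans (normc_sum _ _ _) _.
apply: (@le_trans _ _ (\sum_(j < n.+1) normc (a j) * \sum_(k < n.+1) normc (y k))).
  apply: ler_sum => j _; rewrite Normc.normcM ler_wpM2l ?normc_ge0 //.
  have h : (n - j < n.+1)%N by rewrite ltnS leq_subr.
  by rewrite (bigD1 (Ordinal h)) //= lerDl sumr_ge0 // => i _; exact: normc_ge0.
by rewrite -mulr_suml ler_wpM2r ?ha // sumr_ge0 // => i _; exact: normc_ge0.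
Qed.

(* Newman's proof of Wiener's lemma: with [q = 1 / p], the powers of [e q] tend
   to [0] in l1 norm because those of [q] grow at most like [(2 b) ^ (- n)]. *)
Lemma newman_stable p e (b : R) : 0 < b -> l1bound e b ->
  (forall z, normc z <= 1 -> 4 * b <= normc p.[z]) ->
  exists2 K, 0 <= K & forall y u, (pser_of_poly p - e) * y = u ->
    (forall U, supbound u U -> supbound y (K * U)) /\ (null_seq u -> null_seq y).
Proof.
move=> b0 he hp; have b20 : 0 < 2 * b by rewrite mulr_gt0.
have [|q [D [pq hq]]] := poly_inverse_power_l1 b20 _ hp;
  first by rewrite ltr_pM2r // ltr_nat.
have D0 : 0 <= D by have := l1bound_ge0 (hq 0); rewrite expr0 mulr1.
(* [g n] is a partial Neumann sum for the inverse of p - e and [w n] its remainder. The growth rate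
   1 / (2 b) for powers of q against norm b for e gives the ratio 1/2. *)
pose w n := (e * q) ^+ n; pose g n := \sum_(i < n) e ^+ i * q ^+ i.+1.
have hw n : l1bound (w n) (D * 2^-1 ^+ n).
  rewrite /w exprMn; apply: l1bound_le (l1boundM (l1boundX n he) (hq n)).
  rewrite mulrCA ler_wpM2l // -exprMn invfM mulrCA mulfV ?gt_eqF // mulr1.
  exact: lexx.
have hg n : l1bound (g n) (D / b).
  apply: (@l1bound_le _ _ (\sum_(i < n) D / (2 * b) * 2^-1 ^+ i)).
    rewrite -mulr_sumr; apply: (@le_trans _ _ (D / (2 * b) * 2)).
      rewrite ler_wpM2l ?divr_ge0 ?(ltW b20) //;
        apply: le_trans (geometric_le _ _ _) _ => //.
        by rewrite invf_lt1 // ltr1n.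
      have -> : 1 - 2^-1 = 2^-1 :> R by field.
      by rewrite invrK.
    by rewrite le_eqVlt; apply/orP; left; apply/eqP; field; rewrite gt_eqF.
  rewrite /g; elim: n => [|n IH]; first by rewrite !big_ord0 => k;
    rewrite big1 // => i _; rewrite Normc.normc0.
  rewrite !big_ord_recr /=; apply: l1boundD => //.
  apply: l1bound_le (l1boundM (l1boundX n he) (hq n.+1)).
  have bE : 2^-1 = b * (2 * b)^-1 by field; rewrite gt_eqF.
  have -> : 2^-1 ^+ n = (b * (2 * b)^-1) ^+ n by rewrite -bE.
  rewrite exprMn exprS le_eqVlt; apply/orP; left; apply/eqP.
  by ring.
have gE n y u : (pser_of_poly p - e) * y = u -> y = g n * u + w n * y.
  move=> <-; rewrite mulrA -mulrDl.
  suff -> : g n * (pser_of_poly p - e) + w n = 1 by rewrite mul1r.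
  rewrite /g /w mulr_suml; elim: n => [|n IH]; first by rewrite big_ord0 add0r.
  rewrite big_ord_recr /= -addrA -[RHS]IH; congr (_ + _).
  rewrite !exprMn !exprS.
  transitivity (e ^+ n * q ^+ n * (pser_of_poly p * q)); first by ring.
  by rewrite pq mulr1.
exists (D / b) => [|y u yu]; first by rewrite divr_ge0 // ltW.
have hsup U : supbound u U -> supbound y (D / b * U).
  move=> hu n; apply/ler_addgt0Pr => d d0.
  (* For a fixed coefficient n the remainder can be made small, although m depends on y. *)
  have [m hm] := half_exp_small (D * \sum_(k < n.+1) normc (y k)) d0.
  rewrite {1}(gE m _ _ yu) pserD; apply: le_trans (le_normcD _ _) _.
  apply: lerD; first exact: supboundM (hg m) hu n.
  apply: le_trans (normc_conv_le _ _ (hw m)) _.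
  by rewrite mulrAC ltW.
split=> // u0 d d0; have [U hU] := null_seq_supbound u0.
have d2 : 0 < d / 2 by rewrite divr_gt0.
(* Now that y is bounded, the remainder is small uniformly in n. *)
have [m hm] := half_exp_small (D * (D / b * U)) d2.
have [n0 hn0] := null_seqM (hg m) u0 d2.
exists n0 => n nn0; rewrite (gE m _ _ yu) pserD; apply: le_lt_trans (le_normcD _ _) _.
rewrite [d]splitr; apply: ltrD; first exact: hn0.
apply: le_lt_trans (supboundM (hw m) (hsup _ hU) n) _.
by rewrite mulrAC.
Qed.

End NewmanInverse.

(** * The symbol of the scalar equation *)

Section Symbol.
Variables (R : realType) (a : R).
Hypotheses (a_gt0 : 0 < a) (a_lt1 : a < 1).
Local Notation C := R[i].
Local Notation normc := (@Normc.normc R).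
Local Notation "x %:C" := (real_complex R x) : ring_scope.
Implicit Types (x z lam : C).

(** Beyond index 0 the coefficients are negative, so their absolute values telescope to d_n -
    d_m. *)
Lemma Cpoly_dist n m x : (n <= m)%N -> normc x <= 1 ->
  normc ((Cpoly a m).[x] - (Cpoly a n).[x]) <= dcoef a n - dcoef a m.
Proof.
move=> nm x1; rewrite -(subnKC nm); elim: (m - n)%N => [|k IH].
  by rewrite addn0 !subrr Normc.normc0.
rewrite addnS CpolyS hornerD addrAC.
apply: le_trans (le_normcD _ _) _; rewrite dcoefS.
have -> : dcoef a n - (dcoef a (n + k) + ccoef a (n + k).+1) =
  dcoef a n - dcoef a (n + k) + - ccoef a (n + k).+1 by ring.
apply: lerD => //; rewrite hornerM hornerC hornerXn Normc.normcM normc_real.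
have c0 := ccoefS_lt0 a_gt0 a_lt1 (n + k).
rewrite ltr0_norm // ler_piMr ?oppr_ge0 ?(ltW c0) //.
by rewrite normcX exprn_ile1 ?normc_ge0.
Qed.

Lemma Cpoly_horner1 n : (Cpoly a n).[1] = (dcoef a n)%:C.
Proof.
rewrite horner_poly -sum_ccoef rmorph_sum; apply: eq_bigr => i _.
by rewrite expr1n mulr1.
Qed.

Lemma cpow0 : cpow (0 : C) a = 0.
Proof. by rewrite /cpow eqxx. Qed.

Lemma cpow1B_neq0 x : normc x <= 1 -> x != 1 -> cpow (1 - x) a != 0.
Proof.
move=> x1 xn1; have := Re_lt1 x1 xn1; case: x {x1 xn1} => x1 x2 /= h.
have -> : 1 - Complex x1 x2 = Complex (1 - x1) (- x2).
  by apply/eqP; rewrite eq_complex /= sub0r !eqxx.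
by rewrite cpow_neq0 // subr_gt0.
Qed.

Lemma dcoef_eventually_lt (K e : R) N : 0 < e ->
  exists2 n, (N <= n)%N & K * dcoef a n < e.
Proof.
move=> e0; have [K0|K0] := leP K 0.
  exists N => //; apply: le_lt_trans e0.
  by rewrite mulr_le0_ge0 // ltW // dcoef_gt0.
have eK : 0 < e / K by rewrite divr_gt0.
have [n hn] := dcoef_cvg0 a_gt0 a_lt1 eK; exists (maxn N n); first exact: leq_maxl.
by rewrite mulrC -ltr_pdivlMr // hn // leq_maxr.
Qed.

(** An error bound uniform on the disc: the constant of [cpow_approx] depends on x, but comparing
    with a later partial sum through [Cpoly_dist] removes it. At x = 1 the convention 0^a = 0 gives
    equality. *)
Lemma Cpoly_cpow n x : normc x <= 1 ->
  normc ((Cpoly a n).[x] - cpow (1 - x) a) <= dcoef a n.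
Proof.
move=> x1; have [->|xn1] := eqVneq x 1.
  by rewrite subrr cpow0 subr0 Cpoly_horner1 normc_real ger0_norm // ltW // dcoef_gt0.
have [K hK] : exists K, forall n, normc ((Cpoly a n).[x] - cpow (1 - x) a) <= K * dcoef a n.
  have := Re_lt1 x1 xn1; case: x x1 {xn1} => u v x1 /= u1.
  exact: cpow_approx.
apply/ler_addgt0Pr => e e0; have [m nm hm] := dcoef_eventually_lt K n e0.
have -> : (Cpoly a n).[x] - cpow (1 - x) a =
  ((Cpoly a m).[x] - cpow (1 - x) a) - ((Cpoly a m).[x] - (Cpoly a n).[x]) by ring.
apply: le_trans (le_normcD _ _) _; rewrite normcN addrC; apply: lerD.
  by apply: le_trans (Cpoly_dist nm x1) _; rewrite gerBl ltW // dcoef_gt0.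
by apply: le_trans (hK m) _; exact: ltW.
Qed.

Lemma poly_lipschitz (p : {poly C}) : exists2 L : R, 0 < L & forall x z,
  normc x <= 1 -> normc z <= 1 -> normc (p.[x] - p.[z]) <= L * normc (x - z).
Proof.
elim/poly_ind: p => [|p c [L L0 hL]].
  by exists 1 => // x z _ _; rewrite !horner0 subrr Normc.normc0 mul1r normc_ge0.
have [P hP] := l1bound_poly p; have P0 := l1bound_ge0 hP.
exists (L + P) => [|x z x1 z1]; first by rewrite ltr_pwDl.
rewrite !hornerE.
have -> : p.[x] * x + c - (p.[z] * z + c) = (p.[x] - p.[z]) * x + p.[z] * (x - z) by ring.
apply: le_trans (le_normcD _ _) _; rewrite !Normc.normcM mulrDl; apply: lerD.
  by apply: le_trans (hL x z x1 z1); rewrite ler_piMr ?normc_ge0.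
by rewrite ler_wpM2r ?normc_ge0 // normc_horner_le.
Qed.

Lemma increasing_seq_id_le (f : nat -> nat) : increasing_seq f -> forall n, (n <= f n)%N.
Proof.
move=> hf; elim=> // n IH; apply: leq_ltn_trans IH _.
by rewrite ltnNge -[(_ <= _)%N]/(f n.+1 <= f n)%O hf ltnn.
Qed.

Lemma disc_compact (w : nat -> C) : (forall n, normc (w n) <= 1) ->
  exists z, forall e : R, 0 < e -> forall N, exists2 n, (N <= n)%N & normc (w n - z) < e.
Proof.
move=> hw.
have bnd (u : nat -> R) : (forall n, `|u n| <= 1) -> bounded_fun u.
  by move=> hu; exists 1; split=> // M M1 n _; exact: le_trans (hu n) (ltW M1).
have [|f hf /cvg_ex[/= s hs]] := @bolzano_weierstrass R (fun n => complex.Re (w n)).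
  by apply: bnd => n; exact: le_trans (Re_le_normc _) (hw n).
(* The second extraction runs along the first, so both coordinates converge along f o g. *)
have [|g hg /cvg_ex[/= t ht]] := @bolzano_weierstrass R (fun n => complex.Im (w (f n))).
  by apply: bnd => n; exact: le_trans (Im_le_normc _) (hw _).
exists (Complex s t) => e e0 N; have e2 : 0 < e / 2 by rewrite divr_gt0.
move/cvgrPdist_lt: hs => /(_ _ e2)[n1 _ h1]; move/cvgrPdist_lt: ht => /(_ _ e2)[n2 _ h2].
pose k := maxn N (maxn n1 n2).
have kg := increasing_seq_id_le hg k; have kf := increasing_seq_id_le hf (g k).
exists (f (g k)); first by apply: leq_trans (leq_trans kg kf); rewrite leq_maxl.
apply: le_lt_trans (normc_le_ReIm _) _; rewrite [e]splitr; apply: ltrD.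
  have := h1 (g k); rewrite /= distrC; case: (w _) => ? ? /=; apply.
  by apply: leq_trans kg; rewrite !leq_max leqnn orbT.
have := h2 k; rewrite /= distrC; case: (w _) => ? ? /=; apply.
by rewrite !leq_max leqnn !orbT.
Qed.

(** Compactness: if the bound failed for every n, the bad points would cluster at a zero of the
    symbol. The level 4 d_n is four times the l1 norm of the discarded tail, as [newman_stable]
    requires. *)
Lemma symbol_lower_bound lam :
  (forall x, normc x <= 1 -> cpow (1 - x) a != lam * x) ->
  exists n, forall x, normc x <= 1 -> 4 * dcoef a n <= normc (Cpoly a n - lam *: 'X).[x].
Proof.
move=> hlam; apply: contrapT => /forallNP H.
have {H} /choice[w hw] : forall n, exists x, normc x <= 1 /\
    normc (Cpoly a n - lam *: 'X).[x] < 4 * dcoef a n.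
  move=> n; have /existsNP[x /not_implyP[x1 /negP hx]] := H n.
  by exists x; split=> //; rewrite ltNge.
have [z hz] := disc_compact (fun n => (hw n).1).
have z1 : normc z <= 1.
  apply/ler_addgt0Pr => e e0; have [n _ hn] := hz _ e0 0.
  have -> : z = w n - (w n - z) by ring.
  by apply: le_trans (le_normcD _ _) _; rewrite normcN lerD ?(hw n).1 // ltW.
have := hlam z z1; rewrite -subr_eq0 => /eqP; apply; apply: Normc.eq0_normc.
apply/eqP; rewrite eq_le normc_ge0 andbT; apply/ler_addgt0Pr => e e0; rewrite add0r.
(* Seven shares: one each for the truncation at z, the Lipschitz step and the change of truncation,
   and four for the bound 4 d_k at the bad point. *)
have e7 : 0 < e / 7 by rewrite divr_gt0.
have [m hm] := dcoef_cvg0 a_gt0 a_lt1 e7.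
pose P n := Cpoly a n - lam *: 'X.
have [L L0 hL] := poly_lipschitz (P m).
have eL : 0 < e / 7 / L by rewrite divr_gt0.
have [k mk hk] := hz _ eL m.
have -> : cpow (1 - z) a - lam * z = - ((Cpoly a m).[z] - cpow (1 - z) a)
   - ((P m).[w k] - (P m).[z]) - ((P k).[w k] - (P m).[w k]) + (P k).[w k].
  by rewrite /P !(hornerD, hornerN, hornerZ, hornerX); ring.
have b1 := Cpoly_cpow m z1.
have b2 : normc ((P m).[w k] - (P m).[z]) <= e / 7.
  apply: le_trans (hL _ _ (hw k).1 z1) _.
  by rewrite mulrC -ler_pdivlMr // ltW.
have b3 : normc ((P k).[w k] - (P m).[w k]) <= dcoef a m.
  have -> : (P k).[w k] - (P m).[w k] = (Cpoly a k).[w k] - (Cpoly a m).[w k].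
    by rewrite /P !(hornerD, hornerN); ring.
  by apply: le_trans (Cpoly_dist mk (hw k).1) _; rewrite gerBl ltW // dcoef_gt0.
have b4 := (hw k).2.
have d1 := hm m (leqnn m); have d2 := hm k mk.
have b4' : normc (P k).[w k] <= 4 * dcoef a k by exact: ltW b4.
apply: le_trans (le_normcD _ _) _.
apply: le_trans (lerD (le_normcD _ _) (lexx _)) _.
apply: le_trans (lerD (lerD (le_normcD _ _) (lexx _)) (lexx _)) _.
rewrite !normcN; lra.
Qed.

Definition cser : pser C := fun k => (ccoef a k)%:C.
Definition dser : pser C := fun k => (dcoef a k)%:C.
(** The series 1 / (1 - X); multiplying by it takes partial sums. *)
Definition ones : pser C := fun => 1.

Lemma onesM (u : pser C) n : (ones * u) n = \sum_(k < n.+1) u k.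
Proof.
rewrite mulrC pserM; apply: eq_bigr => k _; exact: mulr1.
Qed.

Lemma ones_inv : ones * (1 - @pX C) = 1.
Proof.
rewrite mulrBr mulr1 mulrC; apply/funext => n; rewrite pserD pserN pXM pser1.
by case: n => [|n] /=; rewrite ?subr0 // subrr.
Qed.

Lemma ones_cser : ones * cser = dser.
Proof.
by apply/funext => n; rewrite onesM /dser -sum_ccoef rmorph_sum.
Qed.

Lemma sum_ccoef_tail n N : \sum_(k < N | (n < k)%N) `|ccoef a k| <= dcoef a n.
Proof.
suff H k : \sum_(i < k) `|ccoef a (n.+1 + i)| = dcoef a n - dcoef a (n + k).
  case: (leqP N n.+1) => h.
    rewrite big_pred0 ?(ltW (dcoef_gt0 _ _)) // => i; apply/negbTE.
    by rewrite -leqNgt -ltnS (leq_trans (ltn_ord i)).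
  rewrite -(subnKC (ltnW h)) big_split_ord /= big_pred0 ?add0r; last first.
    by move=> i; rewrite ltnNge -ltnS ltn_ord.
  rewrite (eq_bigl xpredT) => [|i]; last by rewrite leq_addr.
  by rewrite H gerBl ltW // dcoef_gt0.
elim: k => [|k IH]; first by rewrite big_ord0 addn0 subrr.
rewrite big_ord_recr IH addnS dcoefS -[X in `|ccoef a X|]/(n + k).+1.
rewrite ltr0_norm ?ccoefS_lt0 //; move: (ccoef _ _) => c.
by rewrite opprD addrA.
Qed.

(** The symbol is a polynomial minus the series e, the negated tail of c, whose l1 norm is at most
    d_n. *)
Lemma symbol_stable lam :
  (forall x, normc x <= 1 -> cpow (1 - x) a != lam * x) ->
  exists2 K, 0 <= K & forall y u : pser C, (cser - pconst lam * @pX C) * y = u ->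
    (forall U, supbound u U -> supbound y (K * U)) /\ (null_seq u -> null_seq y).
Proof.
move=> /symbol_lower_bound[n hn].
pose e : pser C := fun k => if (n < k)%N then - cser k else 0.
have he : l1bound e (dcoef a n).
  move=> N; apply: le_trans (sum_ccoef_tail n N); rewrite [leRHS]big_mkcond.
  apply: ler_sum => k _; rewrite /e; case: ifP => _; last by rewrite Normc.normc0.
  by rewrite normcN normc_real.
have -> : cser - pconst lam * @pX C = pser_of_poly (Cpoly a n - lam *: 'X) - e.
  apply/funext => k; rewrite !(pserD, pserN) pconstM /pser_of_poly coefB coefZ coefX coef_poly.
  rewrite /pX ltnS /e /cser ltnNge; case: ifP => _ /=; first by rewrite subr0.
  by rewrite sub0r opprK addrC.
exact: newman_stable (dcoef_gt0 a_lt1 n) he hn.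
Qed.

Lemma pconst_pscale (r x : C) (u : pser C) : pscale x (pconst r * u) = pconst r * pscale x u.
Proof. by apply/funext => n; rewrite /pscale !pconstM mulrA. Qed.

Lemma pscale_pX x : pscale x (@pX C) = pconst x * @pX C.
Proof.
apply/funext => -[|[|n]]; rewrite /pscale pconstM /pX /=.
- by rewrite !mulr0 mul0r.
- by rewrite mul1r mulr1 expr1.
- by rewrite mul0r mulr0.
Qed.

Lemma ones_pscale_cser x n : (ones * pscale x cser) n = (Cpoly a n).[x].
Proof. by rewrite onesM horner_poly. Qed.

(* Abel summation; the coefficients are monotone from index 1 on. *)
Lemma Cpoly_tail_le n x : normc x <= 1 ->
  normc ((1 - x) * ((Cpoly a n).[x] - cpow (1 - x) a)) <= 2 * `|ccoef a n.+1|.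
Proof.
move=> x1.
(* The boundary term turns the increments of Q into (c_(k+1) - c_k) x^(k+1), whose nonnegative
   coefficients telescope. *)
pose Q m := (1 - x) * ((Cpoly a m).[x] - (Cpoly a n).[x]) + (ccoef a m)%:C * x ^+ m.+1.
have hQ k : normc (Q (n.+1 + k)%N) <= - 2 * ccoef a n.+1 + ccoef a (n.+1 + k).
  elim: k => [|k IH].
    have -> : Q (n.+1 + 0)%N = (ccoef a n.+1)%:C * x ^+ n.+1.
      rewrite /Q addn0 CpolyS hornerD hornerM hornerC hornerXn [x ^+ n.+2]exprS; ring.
    rewrite Normc.normcM normc_real ltr0_norm ?ccoefS_lt0 // addn0.
    have : normc (x ^+ n.+1) <= 1 by rewrite normcX exprn_ile1 ?normc_ge0.
    have := ccoefS_lt0 a_gt0 a_lt1 n; nra.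
  rewrite addnS.
  have -> : Q (n.+1 + k).+1 = Q (n.+1 + k)%N +
      (ccoef a (n.+1 + k).+1 - ccoef a (n.+1 + k))%:C * x ^+ (n.+1 + k).+1.
    rewrite /Q CpolyS hornerD hornerM hornerC hornerXn [x ^+ (_.+2)]exprS rmorphB /=; ring.
  apply: le_trans (le_normcD _ _) _; rewrite Normc.normcM normc_real.
  have h : ccoef a (n.+1 + k) <= ccoef a (n.+1 + k).+1 by rewrite addSn ccoef_le // leqnSn.
  rewrite ger0_norm ?subr_ge0 //.
  have : normc (x ^+ (n.+1 + k).+1) <= 1 by rewrite normcX exprn_ile1 ?normc_ge0.
  move: IH h; nra.
apply/ler_addgt0Pr => e e0.
have [m nm hm] := dcoef_eventually_lt (normc (1 - x)) n.+1 e0.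
have {hQ} : normc (Q m) <= - 2 * ccoef a n.+1 + ccoef a m by rewrite -(subnKC nm).
rewrite ltr0_norm ?ccoefS_lt0 //.
have -> : (1 - x) * ((Cpoly a n).[x] - cpow (1 - x) a) =
  (1 - x) * ((Cpoly a m).[x] - cpow (1 - x) a) + (ccoef a m)%:C * x ^+ m.+1 - Q m.
  by rewrite /Q; ring.
have b1 : normc ((1 - x) * ((Cpoly a m).[x] - cpow (1 - x) a)) <= e.
  rewrite Normc.normcM; apply: le_trans (ltW hm).
  by rewrite ler_wpM2l ?normc_ge0 // Cpoly_cpow.
have b2 : normc ((ccoef a m)%:C * x ^+ m.+1) <= - ccoef a m.
  case: m nm {hm b1} => // m _; have c0 := ccoefS_lt0 a_gt0 a_lt1 m.
  rewrite Normc.normcM normc_real ltr0_norm // ler_piMr ?oppr_ge0 ?(ltW c0) //.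
  by rewrite normcX exprn_ile1 ?normc_ge0.
move=> b3; apply: le_trans (le_normcD _ _) _; rewrite normcN.
apply: le_trans (lerD (le_normcD _ _) (lexx _)) _; lra.
Qed.

End Symbol.

(** * The memory kernel as a binomial series, and the obstruction to decay *)

Section FracCoef.
Variables (R : realType) (a : R).
Hypotheses (a_gt0 : 0 < a) (a_lt1 : a < 1).
Local Notation C := R[i].
Local Notation normc := (@Normc.normc R).
Local Notation "x %:C" := (real_complex R x) : ring_scope.
Local Notation cser := (cser a).
Local Notation dser := (dser a).
Local Notation ones := (ones R).

Definition pderiv (u : pser C) : pser C := fun n => n.+1%:R * u n.+1.

Lemma pderivM (u v : pser C) : pderiv (u * v) = pderiv u * v + u * pderiv v.
Proof.
apply/funext => n; rewrite /pderiv pserD -[(u * v) n.+1]/(pmul u v n.+1) (@pmulE _ n.+1) //.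
have E (f g : {poly C}) (w z : pser C) : (forall k, (k <= n)%N -> f`_k = w k) ->
    (forall k, (k <= n)%N -> g`_k = z k) -> (f * g)`_n = (w * z) n.
  move=> hf hg; rewrite coefM pserM; apply: eq_bigr => j _.
  by rewrite hf ?hg ?leq_subr // -ltnS.
rewrite mulr_natl -coef_deriv derivM coefD; congr (_ + _); apply: E => k kn.
- by rewrite coef_deriv ptruncE // mulr_natl.
- by rewrite ptruncE // leqW.
- by rewrite ptruncE // leqW.
- by rewrite coef_deriv ptruncE // mulr_natl.
Qed.

Definition bser : pser C := fun k => (frac_coef a k)%:C.

Lemma binomial_ode (u : pser C) (s : C) :
  (forall k, k.+1%:R * u k.+1 = (k%:R + s) * u k) ->
  (1 - @pX C) * pderiv u = pconst s * u.
Proof.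
move=> h; apply/funext => n; rewrite mulrBl mul1r pserD pserN pXM pconstM /pderiv.
by case: n => [|n]; rewrite h ?subr0 ?add0r // mulrDl addrAC subrr add0r.
Qed.

(** The two first-order equations make the derivative of the product vanish, and its constant term
    is 1. *)
Lemma cser_bser : cser * bser = 1.
Proof.
have hb : (1 - @pX C) * pderiv bser = pconst (a%:C) * bser.
  apply: binomial_ode => k; rewrite /bser -!(rmorph_nat (real_complex R)) -rmorphD -!rmorphM /=.
  by rewrite frac_coefS.
have hc : (1 - @pX C) * pderiv cser = pconst (- a%:C) * cser.
  apply: binomial_ode => k.
  rewrite /cser -!(rmorph_nat (real_complex R)) -rmorphN -rmorphD -!rmorphM.
  by congr (_%:C); rewrite ccoefS -ccoefE; ring.
have h : pderiv (cser * bser) = 0.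
  rewrite -[LHS]mul1r -(ones_inv R) -mulrA pderivM mulrDr.
  rewrite mulrA hc [_ * (cser * _)]mulrCA hb.
  have -> : pconst (- a%:C) = - pconst a%:C :> pser C.
    by apply/funext => -[|n]; rewrite pserN /pconst ?oppr0.
  ring.
apply/funext => -[|n].
  rewrite pserM big_ord1 /cser /bser frac_coef0 ?ltW //= pser1 mulr1 //.
apply/eqP; rewrite pser1 /= -(inj_eq (@mulfI C n.+1%:R _)) ?pnatr_eq0 // mulr0.
by apply/eqP; exact: (congr1 (fun f : pser C => f n) h).
Qed.

(** Multiplication by c cancels the kernel and turns the constant forcing, y_0 / (1 - X), into y_0
    d. *)
Lemma solution_series (y v : pser C) :
  (forall t, y t.+1 = y 0 + (bser * v) t) ->
  cser * y = pconst (y 0) * dser + @pX C * v.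
Proof.
move=> h; have yE : y = pconst (y 0) * ones + @pX C * (bser * v).
  by apply/funext => -[|t]; rewrite pserD pXM pconstM mulr1; [rewrite addr0|exact: h].
rewrite {1}yE mulrDr mulrCA [cser * ones]mulrC ones_cser.
by rewrite [cser * (_ * _)]mulrCA [cser * (_ * _)]mulrA cser_bser mul1r.
Qed.

Lemma null_seq_const (c : C) : null_seq (fun=> c) -> c = 0.
Proof.
move=> h; apply: Normc.eq0_normc; apply/eqP; rewrite eq_le normc_ge0 andbT leNgt.
by apply/negP => /h[n /(_ n (leqnn n))]; rewrite ltxx.
Qed.

Lemma null_seq_pscale (x : C) (y : pser C) : normc x <= 1 -> null_seq y -> null_seq (pscale x y).
Proof.
move=> x1 hy e e0; have [n0 hn0] := hy _ e0; exists n0 => n /hn0; apply: le_lt_trans.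
by rewrite Normc.normcM ler_piMr ?normc_ge0 // normcX exprn_ile1 ?normc_ge0.
Qed.

Lemma symbol_unstable (lam x : C) (y : pser C) : normc x <= 1 ->
  cpow (1 - x) a = lam * x ->
  (cser - pconst lam * @pX C) * y = pconst (y 0) * dser -> null_seq y -> y 0 = 0.
Proof.
move=> x1 hx hy y0; have [x_eq1|xn1] := eqVneq x 1.
  have lam0 : lam = 0 by move: hx; rewrite x_eq1 subrr cpow0 mulr1.
  have y_const : y = fun=> y 0.
    transitivity (pconst (y 0) * ones); last first.
      by apply/funext => n; rewrite pconstM mulr1.
    have hy' : cser * y = pconst (y 0) * (ones * cser).
      have p0 : pconst 0 * @pX C = 0 by apply/funext => n; rewrite pconstM mul0r.
      by rewrite ones_cser -hy lam0 p0 subr0.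
    transitivity (bser * (cser * y)).
      by rewrite mulrA [bser * _]mulrC cser_bser mul1r.
    rewrite hy'; transitivity (pconst (y 0) * ones * (cser * bser)); first by ring.
    by rewrite cser_bser mulr1.
  by apply: null_seq_const; rewrite -y_const.
pose c := cpow (1 - x) a; have c0 : c != 0 by exact: cpow1B_neq0.
have x10 : 1 - x != 0 by rewrite subr_eq0 eq_sym.
(* [r] is the error sequence C_n(x) - (1 - x)^a; it is summable by [Cpoly_tail_le] and null by
   [Cpoly_cpow]. *)
pose yx := pscale x y; pose r := ones * pscale x cser - pconst c * ones.
have yx0 : null_seq yx by exact: null_seq_pscale.
have rl1 : l1bound r (2 / normc (1 - x)).
  have nx0 : 0 < normc (1 - x).
    by rewrite lt_neqAle normc_ge0 andbT eq_sym;
      apply: contra x10 => /eqP /Normc.eq0_normc ->.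
  move=> N; rewrite ler_pdivlMr // mulr_suml.
  apply: (@le_trans _ _ (\sum_(k < N) 2 * `|ccoef a k.+1|)).
    apply: ler_sum => k _; rewrite -Normc.normcM mulrC.
    by rewrite /r pserD pserN ones_pscale_cser pconstM mulr1 Cpoly_tail_le.
  rewrite -mulr_sumr ler_piMr //; apply: le_trans (sum_ccoef_tail a_gt0 a_lt1 0 N.+1).
  by rewrite [leRHS]big_mkcond big_ord_recl /= add0r.
have pC : pconst c = pconst lam * pconst x :> pser C.
  by apply/funext => -[|n]; rewrite pconstM /pconst ?mulr0 // /c hx.
have p1x : pconst (1 - x) = 1 - pconst x :> pser C.
  by apply/funext => -[|n]; rewrite pserD pserN pser1 /pconst ?subr0.
have JX : ones * @pX C = ones - 1 by rewrite -(ones_inv R); ring.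
have F1 : pscale x cser * yx =
    pconst (y 0) * pscale x dser + pconst lam * pconst x * @pX C * yx.
  have := congr1 (pscale x) hy; rewrite mulrBl pscaleD pconst_pscale => <-.
  have -> : - (pconst lam * @pX C * y) = pconst (- lam) * (@pX C * y).
    by apply/funext => n; rewrite pserN -mulrA !pconstM mulNr.
  rewrite pconst_pscale !pscaleM pscale_pX -/yx.
  have -> : pconst (- lam) = - pconst lam :> pser C.
    by apply/funext => -[|n]; rewrite pserN /pconst ?oppr0.
  by ring.
have F2 : pscale x cser = pscale x dser - pconst x * @pX C * pscale x dser.
  have -> : cser = dser + pconst (- 1) * (@pX C * dser).
    have -> : pconst (- 1) * (@pX C * dser) = - (@pX C * dser).
      by apply/funext => n; rewrite pserN pconstM mulN1r.
    rewrite -ones_cser -[LHS]mul1r -(ones_inv R); ring.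
  rewrite pscaleD pconst_pscale pscaleM pscale_pX; congr (_ + _).
  by apply/funext => n; rewrite pserN pconstM mulN1r.
(* Partial sums of the equation taken at x. The left side is null, while the right side converges to
   y_0 (1 - x)^a, which must therefore vanish. *)
have key : pconst (1 - x) * (r * yx + pconst c * yx) =
    pconst (y 0) * (ones * pscale x cser - pconst x * pscale x dser).
  rewrite /r pC p1x.
  transitivity ((1 - pconst x) * (ones * (pscale x cser * yx) -
      pconst lam * pconst x * (ones - 1) * yx)); first by ring.
  rewrite F1 -JX F2.
  transitivity (pconst (y 0) * ((1 - pconst x) * ones * pscale x dser)); first by ring.
  transitivity (pconst (y 0) * (ones * pscale x dser
      - pconst x * (ones * @pX C) * pscale x dser - pconst x * pscale x dser));
          last by ring.
  by rewrite JX; ring.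
have pl1 (s : C) (u : pser C) : null_seq u -> null_seq (pconst s * u).
  have [K hK] := l1bound_poly s%:P; apply: null_seqM (K) _.
  have -> // : pconst s = pser_of_poly s%:P.
  by apply/funext => -[|n]; rewrite /pser_of_poly coefC.
have r0 : null_seq r.
  move=> e e0; have [n0 hn0] := dcoef_cvg0 a_gt0 a_lt1 e0; exists n0 => n /hn0.
  apply: le_lt_trans; rewrite /r pserD pserN ones_pscale_cser pconstM mulr1.
  exact: Cpoly_cpow.
have d0 : null_seq (pscale x dser).
  apply: null_seq_pscale => // e e0; have [n0 hn0] := dcoef_cvg0 a_gt0 a_lt1 e0.
  by exists n0 => n /hn0; rewrite normc_real ger0_norm // ltW // dcoef_gt0.
suff : y 0 * c = 0 by move/eqP; rewrite mulf_eq0 (negbTE c0) orbF => /eqP.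
apply: null_seq_const.
have -> : (fun=> y 0 * c) = pconst (1 - x) * (r * yx + pconst c * yx) +
    (pconst (- y 0) * r + pconst (y 0) * (pconst x * pscale x dser)) :> pser C.
  have -> : pconst (- y 0) * r = - (pconst (y 0) * r).
    by apply/funext => n; rewrite pserN !pconstM mulNr.
  transitivity (pconst (y 0) * (pconst c * ones)).
    by apply/funext => n; rewrite !pconstM mulr1.
  by rewrite key /r; ring.
apply: null_seqD; last first.
  by apply: null_seqD; [exact: (pl1 _ _ r0)|exact: (pl1 _ _ (pl1 _ _ d0))].
exact: pl1 _ _ (null_seqD (null_seqM rl1 yx0) (pl1 _ _ yx0)).
Qed.

End FracCoef.

(** * Linear systems *)

Section System.
Variables (R : realType) (a : R).
Hypotheses (a_gt0 : 0 < a) (a_lt1 : a < 1).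
Local Notation C := R[i].
Local Notation normc := (@Normc.normc R).
Local Notation "x %:C" := (real_complex R x) : ring_scope.
Local Notation cser := (cser a).
Local Notation dser := (dser a).

(** The recursion uses the whole history: stage n of [S] stores the values up to n, and later stages
    leave them unchanged. *)
Lemma solution_exists N (A : 'M[R]_N) (X0 : 'cV[R]_N) :
  exists2 X, is_solution a A X & X 0 = X0.
Proof.
pose next (S : nat -> 'cV[R]_N) n := X0 + \sum_(j < n.+1) frac_coef a (n - j) *: ((A - 1%:M) *m S j).
pose S := fix S n : nat -> 'cV[R]_N := if n is m.+1 then
  (fun k => if k == m.+1 then next (S m) m else S m k) else (fun=> X0).
have SE n k : (k <= n)%N -> S n k = S k k.
  elim: n => [|n IH]; first by rewrite leqn0 => /eqP ->.
  rewrite leq_eqVlt => /predU1P[-> //|kn]; rewrite -IH //= ifN //.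
  by rewrite neq_ltn kn.
exists (fun n => S n n) => // t; rewrite /= eqxx /next; congr (_ + _).
by apply: eq_bigr => j _; rewrite SE // -ltnS.
Qed.

Section Functional.
Variables (N : nat) (A : 'M[R]_N).
Local Notation BC := (map_mx (real_complex R) (A - 1%:M)).

(** A scalar observable of the trajectory; w is complex so that it may be a left eigenvector. *)
Definition functional (w : 'rV[C]_N) (X : nat -> 'cV[R]_N) : pser C :=
  fun t => (w *m map_mx (real_complex R) (X t)) 0 0.

Lemma functional_solution w X : is_solution a A X ->
  cser * functional w X =
  pconst (functional w X 0) * dser + @pX C * functional (w *m BC) X.
Proof.
move=> hX; apply: solution_series => // t.
rewrite {1}/functional hX map_mxD mulmxDr mxE; congr (_ + _).
rewrite mulrC pserM raddf_sum mulmx_sumr summxE; apply: eq_bigr => j _.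
by rewrite /= map_mxZ map_mxM -scalemxAr mxE mulrC /functional mulmxA.
Qed.

Lemma functional_le w X t : normc (functional w X t) <= (\sum_i normc (w 0 i)) * vnorm (X t).
Proof.
rewrite /functional mxE; apply: le_trans (normc_sum _ _ _) _.
rewrite mulr_suml; apply: ler_sum => i _; rewrite Normc.normcM mxE normc_real.
rewrite ler_wpM2l ?normc_ge0 // /vnorm (bigD1 i) //= lerDl sumr_ge0 //.
Qed.

End Functional.

(** The root condition in the variable x = 1 / z; at x = 0 it holds for every [lam], the power being
    nonzero there. *)
Definition regular_eigenvalue (lam : C) :=
  forall x, normc x <= 1 -> cpow (1 - x) a != lam * x.

(** Induction on the factors, which also covers Jordan blocks: w (B - lam) is killed by the
    remaining product, so its observable decays. It is the forcing term in the equation with symbol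
    c - lam X for w, to which [symbol_stable] applies. *)
Lemma functional_decay n (A : 'M[R]_n.+1) (l : seq C) :
  (forall lam, lam \in l -> regular_eigenvalue lam) -> forall w : 'rV[C]_n.+1,
  w *m horner_mx (map_mx (real_complex R) (A - 1%:M)) (\prod_(lam <- l) ('X - lam%:P)) = 0 ->
  exists2 K, 0 <= K & forall X, is_solution a A X ->
    supbound (functional w X) (K * vnorm (X 0)) /\ null_seq (functional w X).
Proof.
set B := map_mx _ _; elim: l => [|lam l IH] hl w.
  rewrite big_nil rmorph1 mulmx1 => ->; exists 0 => // X hX.
  have F0 t : functional 0 X t = 0 by rewrite /functional mul0mx mxE.
  split=> [t|e e0]; first by rewrite F0 Normc.normc0 mul0r.
  by exists 0 => t _; rewrite F0 Normc.normc0.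
rewrite big_cons rmorphM => hw.
have {IH} [] := IH _ (w *m (B - lam%:M)).
- by move=> mu hmu; apply: hl; rewrite inE hmu orbT.
- by rewrite -mulmxA -[RHS]hw rmorphB /= horner_mx_X horner_mx_C.
move=> K K0 hK; have [|L L0 hL] := symbol_stable a_gt0 a_lt1 (lam := lam).
  by apply: hl; rewrite inE eqxx.
pose W := \sum_i normc (w 0 i).
have W0 : 0 <= W by rewrite sumr_ge0 // => i _; exact: normc_ge0.
exists (L * (W + K)) => [|X hX]; first by rewrite mulr_ge0 // addr_ge0.
have [hK1 hK2] := hK X hX.
have V0 : 0 <= vnorm (X 0) by rewrite sumr_ge0.
pose u := pconst (functional w X 0) * dser + @pX C * functional (w *m (B - lam%:M)) X.
have hu : (cser - pconst lam * @pX C) * functional w X = u.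
  rewrite mulrBl (functional_solution w hX) /u -addrA; congr (_ + _).
  have -> : functional (w *m (B - lam%:M)) X = functional (w *m B) X - pconst lam * functional w X.
    apply/funext => t; rewrite pserD pserN pconstM /functional mulmxBr mulmxBl mul_mx_scalar.
    by rewrite -scalemxAl !mxE.
  ring.
have [h1 h2] := hL _ _ hu; split.
  rewrite -mulrA; apply: h1 => t; rewrite /u pserD; apply: le_trans (le_normcD _ _) _.
  rewrite mulrDl; apply: lerD.
    rewrite pconstM Normc.normcM normc_real ger0_norm ?(ltW (dcoef_gt0 a_lt1 _)) //.
    apply: le_trans (functional_le w X 0).
    by rewrite ler_piMr ?normc_ge0 // dcoef_le1.
  rewrite pXM; case: t => [|t]; last exact: hK1.
  by rewrite Normc.normc0 mulr_ge0.
apply: h2; apply: null_seqD.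
  move=> e e0; pose c := normc (functional w X 0);
    have c1 : 0 < c + 1 by rewrite ltr_wpDl ?normc_ge0.
  have [n0 hn0] := dcoef_cvg0 a_gt0 a_lt1 (divr_gt0 e0 c1).
  exists n0 => m /hn0 hm; rewrite pconstM Normc.normcM normc_real ger0_norm ?(ltW (dcoef_gt0 a_lt1 _)) //.
  move: hm; rewrite ltr_pdivlMr // mulrC; apply: le_lt_trans.
  by rewrite ler_wpM2r ?(ltW (dcoef_gt0 a_lt1 _)) // lerDl.
move=> e /hK2[n0 hn0]; exists n0.+1 => -[//|m] hm; rewrite pXM; exact: hn0.
Qed.

Lemma cvg_vnorm N (X : nat -> 'cV[R]_N) :
  (forall i, null_seq (fun t => (X t i 0)%:C)) -> vnorm (X t) @[t --> \oo] --> (0 : R).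
Proof.
move=> h; have -> : 0 = \sum_(i < N) 0 :> R by rewrite big1.
rewrite /vnorm; apply: cvg_big => [|i _]; first exact: add_continuous.
apply/cvgrPdist_lt => e e0; have [n0 hn0] := h i e e0.
by exists n0 => // t /hn0; rewrite normc_real sub0r normrN normr_id.
Qed.

Lemma null_seq_vnorm N (X : nat -> 'cV[R]_N) w :
  vnorm (X t) @[t --> \oo] --> (0 : R) -> null_seq (functional w X).
Proof.
move=> h e e0; pose W := \sum_i normc (w 0 i).
have W1 : 0 < W + 1 by rewrite ltr_wpDl // sumr_ge0 // => i _; exact: normc_ge0.
move/cvgrPdist_lt : h => /(_ _ (divr_gt0 e0 W1))[n0 _ hn0].
exists n0 => t /hn0 /=; rewrite sub0r normrN.
have V0 : 0 <= vnorm (X t) by rewrite sumr_ge0.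
rewrite ger0_norm // ltr_pdivlMr // mulrC; apply: le_lt_trans.
by apply: le_trans (functional_le w X t) _; rewrite ler_wpM2r // lerDl.
Qed.

Lemma char_mx_kernel N (A : 'M[R]_N) (z : C) (v : 'rV[C]_N) :
  (v *m char_mx a A z == 0) =
  (v *m map_mx (real_complex R) (A - 1%:M) == (z * cpow (1 - z^-1) a) *: v).
Proof.
by rewrite /char_mx mulmxBr -scalemxAr mulmx1 subr_eq0 eq_sym.
Qed.

(** A zero x of the symbol is nonzero, and z = 1 / x is then a characteristic root with |z| >= 1. *)
Lemma char_roots_regular N (A : 'M[R]_N) (lam : C) (v : 'rV[C]_N) :
  (forall z, \det (char_mx a A z) = 0 -> normc z < 1) ->
  v != 0 -> v *m map_mx (real_complex R) (A - 1%:M) = lam *: v -> regular_eigenvalue lam.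
Proof.
move=> hdet v0 hv x x1; apply/eqP => hx.
have x0 : x != 0.
  apply/eqP => x0; have := @cpow1B_neq0 R a x x1.
  by rewrite hx x0 mulr0 eqxx eq_sym oner_neq0 => /(_ isT).
have : normc x^-1 < 1.
  apply: hdet; apply/eqP/det0P; exists v => //; apply/eqP; rewrite char_mx_kernel invrK hx.
  by rewrite mulrCA mulVf // mulr1 hv.
have nx0 : 0 < normc x.
  by rewrite lt_neqAle normc_ge0 andbT eq_sym; apply: contra x0 => /eqP /Normc.eq0_normc ->.
by rewrite Normc.normcV invf_lt1 // ltNge x1.
Qed.

End System.

Theorem theorem1 (R : realType) (alpha : R) (N : nat) (A : 'M[R]_N) :
  0 < alpha -> alpha < 1 -> (0 < N)%N ->
  (zero_asymp_stable alpha A <->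
   (forall z : R[i], \det (char_mx alpha A z) = 0 -> Normc.normc z < 1)).
Proof.
move=> a0 a1; case: N A => // n A _; split=> [[_ [d d0 hd]] z /eqP/det0P[w w0 /eqP]|hdet].
  rewrite char_mx_kernel; set lam := z * _ => /eqP hw.
  rewrite ltNge; apply/negP => z1.
  have zn0 : z != 0.
    by apply: contraTneq z1 => ->; rewrite Normc.normc0 -ltNge.
  have [i wi] : exists i, w 0 i != 0 by exact/rV0Pn.
  (* A real initial state within distance d of 0 on which the complex functional w takes the nonzero
     value (d / 2) w_i. *)
  have [X hX X0] := solution_exists alpha A ((d / 2) *: delta_mx i 0).
  have hv : vnorm (X 0) < d.
    rewrite X0 /vnorm (bigD1 i) //= big1 => [|j ji].
      by rewrite !mxE !eqxx mulr1 addr0 gtr0_norm ?divr_gt0 //; lra.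
    by rewrite !mxE (negbTE ji) mulr0 normr0.
  have y0 : functional w X 0 = 0.
    apply: (@symbol_unstable _ _ a0 a1 lam z^-1).
    - by rewrite Normc.normcV invf_le1 // (lt_le_trans ltr01).
    - by rewrite /lam mulrAC mulfV // mul1r.
    - rewrite mulrBl (functional_solution a0 a1 w hX) hw.
      have -> : functional (lam *: w) X = pconst lam * functional w X.
        by apply/funext => t; rewrite pconstM /functional -scalemxAl mxE.
      ring.
    - exact: null_seq_vnorm (hd X hX hv).
  move: y0; rewrite /functional X0 mxE (bigD1 i) //= big1 => [|j ji].
    rewrite !mxE !eqxx mulr1 addr0 => /eqP; rewrite mulf_eq0 (negbTE wi) /=.
    by rewrite eq_complex /= eqxx andbT gt_eqF // divr_gt0.
  by rewrite !mxE (negbTE ji) mulr0 rmorph0 mulr0.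
set B := map_mx (real_complex R) (A - 1%:M).
have [l Dl] := closed_field_poly_normal (char_poly B).
rewrite (monicP (char_poly_monic B)) scale1r in Dl.
have hl lam : lam \in l -> regular_eigenvalue alpha lam.
  move=> laml; have : eigenvalue B lam by rewrite eigenvalue_root_char Dl root_prod_XsubC.
  by case/eigenvalueP => v hv v0; exact: char_roots_regular hdet v0 hv.
(* By Cayley-Hamilton every row vector is killed by the full product, so decay holds for each
   coordinate functional. *)
have hw (w : 'rV[R[i]]_n.+1) : w *m horner_mx B (\prod_(lam <- l) ('X - lam%:P)) = 0.
  by rewrite -Dl Cayley_Hamilton mulmx0.
have /choice[K hK] : forall i : 'I_n.+1, exists K, 0 <= K /\ forall X, is_solution alpha A X ->
    supbound (functional (delta_mx 0 i) X) (K * vnorm (X 0)) /\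
    null_seq (functional (delta_mx 0 i) X).
  by move=> i; have [K K0 HK] := functional_decay a0 a1 hl (hw (delta_mx 0 i)); exists K.
have fE i (X : nat -> 'cV[R]_n.+1) t : functional (delta_mx 0 i) X t = real_complex R (X t i 0).
  by rewrite /functional -rowE !mxE.
split.
  move=> e e0; pose S := \sum_i K i.
  have S1 : 0 < S + 1 by rewrite ltr_wpDl // sumr_ge0 // => i _; case: (hK i).
  (* The norm of X_t is at most S times that of X_0; adding 1 keeps the divisor positive. *)
  exists (e / (S + 1)) => [|X hX hv t]; first by rewrite divr_gt0.
  have V0 : 0 <= vnorm (X 0) by rewrite sumr_ge0.
  apply: (@le_lt_trans _ _ (S * vnorm (X 0))).
    rewrite /S mulr_suml; apply: ler_sum => i _.
    by have [h _] := (hK i).2 X hX; have := h t; rewrite fE normc_real.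
  move: hv; rewrite ltr_pdivlMr // mulrC; apply: le_lt_trans.
  by rewrite ler_wpM2r // lerDl.
(* The decay is global, so any positive radius serves. *)
exists 1 => // X hX _; apply: cvg_vnorm => i.
have [_ h] := (hK i).2 X hX.
by move=> e e0; have [n0 hn0] := h e e0; exists n0 => t /hn0; rewrite fE.
Qed.
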